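(* Let $(M,g)$ be a pseudo-Riemannian manifold of dimension $n\ge2$ with Levi-Civita connection $\nabla$, and let $B_\circ$ be a constant. A function $f$ on $M$ is a solution of the Gallot–Obata–Tanno equation $$\nabla_a\nabla_b\nabla_cf+B_\circ\,(2g_{bc}\nabla_af+g_{ab}\nabla_cf+g_{ca}\nabla_bf)=0$$ if and only if: (i) $\operatorname{grad}f$ is in the projective Weyl nullity, i.e. $W^i{}_{jk\ell}\,\nabla^jf=0$; (ii) $B^g$ is constant with $B^g=B_\circ$ on any open set where $\operatorname{grad}f$ is non-zero; and (iii) the density $\tau^f=f\,\tau^g\in\Gamma(\mathcal E(2))$ satisfies $$\nabla_{(a}\nabla_b\nabla_{c)}\tau^f+4Bg_{(ab}\nabla_{c)}\tau^f+2g_{(ab}(\nabla_{c)}B)\tau^f=0$$ with $B:=B_\circ$.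
   Context: Manifolds are smooth and connected; metrics have arbitrary signature; indices are abstract indices, raised and lowered with $g$; round brackets denote symmetrisation. For the Levi-Civita connection $\nabla$ of $g$: $[\nabla_\ell,\nabla_k]v^j=R^j{}_{i\ell k}v^i$, $R_{jk}=R^a{}_{jak}$, $\mathsf P_{jk}=\frac1{n-1}R_{jk}$, and the projective Weyl tensor is $W^i{}_{jk\ell}=R^i{}_{jk\ell}+\delta^i_\ell\mathsf P_{jk}-\delta^i_k\mathsf P_{j\ell}$. A vector $v\in T_xM$ is in the (projective) Weyl nullity if $W^i{}_{jk\ell}v^j=0$ at $x$. At a point where there is a nonzero vector in the nullity, $B^g$ denotes the number with $\mathsf P^i{}_jv^j=B^gv^i$ for all $v$ in the nullity (it exists and does not depend on $v$). $\mathcal E(1)$ denotes the positive $(2n+2)$-nd root of the oriented line bundle $(\Lambda^nTM)^2$, and $\mathcal E(2)=\mathcal E(1)^{2}$. The metric $g$ determines (as a root of its volume density) a canonical nowhere zero section $\tau^g$ of $\mathcal E(2)$ that is parallel for $\nabla$; to a function $f$ corresponds the density $\tau^f:=f\tau^g$. *)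

(* Defs.v *)
(* Tensor calculus on manifolds in local coordinates.  Points of the model
   space are row vectors, a tensor field is the family of its components in
   the charts of an atlas, subject to the usual transformation laws, and a
   tensorial equation holds when it holds in every chart of the atlas. *)
From HB Require Import structures.
From mathcomp Require Import all_boot all_order all_algebra.
From mathcomp Require Import all_classical all_reals all_analysis.
From mathcomp Require Import ring.

Set Implicit Arguments.
Unset Strict Implicit.
Unset Printing Implicit Defensive.

Import Order.TTheory GRing.Theory Num.Theory.
Import numFieldNormedType.Exports.

Local Open Scope classical_set_scope.
Local Open Scope ring_scope.

Section Smooth.
Variables (R : realType) (n : nat).
Implicit Types (U : set 'rV[R]_n) (F : 'rV[R]_n -> R) (a : 'I_n).

Definition pd a F : 'rV[R]_n -> R := fun u => 'D_(delta_mx 0 a) (F : _ -> R^o) u.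

(* [U] is meant to be open. *)
Fixpoint class_C (k : nat) U F : Prop :=
  (forall u, U u -> {for u, continuous F}) /\
  (if k is k'.+1 then
     forall a, (forall u, U u -> derivable (F : _ -> R^o) u (delta_mx 0 a)) /\
               class_C k' U (pd a F)
   else True).

Definition smooth_on U F : Prop := forall k, class_C k U F.

End Smooth.

Section Manifolds.
Variables (R : realType) (n : nat).

Record chart (T : topologicalType) := Chart {
  cdom : set T;
  coord :> T -> 'rV[R]_n;
  param : 'rV[R]_n -> T;
  cdom_open : open cdom;
  cimg_open : open (coord @` cdom);
  coordK : forall x, cdom x -> param (coord x) = x;
  coord_continuous : {within cdom, continuous coord};
  param_continuous : {within coord @` cdom, continuous param} }.

Definition cimg (T : topologicalType) (c : chart T) : set 'rV[R]_n :=
  c @` cdom c.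

Definition transition (T : topologicalType) (c d : chart T) :
    'rV[R]_n -> 'rV[R]_n :=
  fun u => d (param c u).

Record manifold := Manifold {
  points :> topologicalType;
  atlas : set (chart points);
  manifold_hausdorff : hausdorff_space points;
  manifold_second_countable : @second_countable points;
  manifold_connected : connected [set: points];
  atlas_cover : forall x : points, exists2 c, atlas c & cdom c x;
  atlas_compatible : forall c d, atlas c -> atlas d -> forall b : 'I_n,
    smooth_on (c @` (cdom c `&` cdom d)) (fun u => transition c d u 0 b) }.

Definition smooth_function (M : manifold) (f : M -> R) : Prop :=
  forall c, atlas c -> smooth_on (cimg c) (f \o param c).

(* The row [a] of the Jacobian matrix ['J (transition c d) u] is the
   derivative of the new coordinates in the direction of the [a]-th old one. *)
Record metric (M : manifold) := Metric {
  gcomp :> chart M -> 'rV[R]_n -> 'M[R]_n;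
  metric_smooth : forall c, atlas c -> forall a b : 'I_n,
    smooth_on (cimg c) (fun u => gcomp c u a b);
  metric_sym : forall c, atlas c -> forall u, cimg c u ->
    (gcomp c u)^T = gcomp c u;
  metric_nondegenerate : forall c, atlas c -> forall u, cimg c u ->
    gcomp c u \in unitmx;
  metric_transition : forall c d, atlas c -> atlas d ->
    forall x, cdom c x -> cdom d x ->
    gcomp c (c x) = 'J (transition c d) (c x) *m gcomp d (d x) *m
                    ('J (transition c d) (c x))^T }.

(* Sections of E(w), as components with respect to the w-th power of the
   positive (2n+2)-nd root of the frame (d/dx^1 /\ .. /\ d/dx^n)^2.  That frame
   is det(dy/dx)^2 times the one of the coordinates y, whence the exponent
   2w/(2n+2) of |det(dy/dx)| in the law.  Smoothness is not part of the
   record. *)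
Record density (M : manifold) (w : R) := Density {
  dcomp :> chart M -> 'rV[R]_n -> R;
  density_transition : forall c d, atlas c -> atlas d ->
    forall x, cdom c x -> cdom d x ->
    dcomp d (d x) =
      `|\det ('J (transition c d) (c x))| `^ (w / n.+1%:R) * dcomp c (c x) }.

(* The volume density |det g|^(1/2) is a section of E(-n-1); its power with
   exponent -2/(n+1) is a section of E(2). *)
Definition metric_density_comp (M : manifold) (g : metric M) :
    chart M -> 'rV[R]_n -> R :=
  fun c u => `|\det (g c u)| `^ (- n.+1%:R^-1).

Lemma metric_density_transition (M : manifold) (g : metric M) c d :
  atlas c -> atlas d -> forall x, cdom c x -> cdom d x ->
  metric_density_comp g d (d x) =
    `|\det ('J (transition c d) (c x))| `^ (2 / n.+1%:R) *
    metric_density_comp g c (c x).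
Proof.
move=> cA dA x cx dx; rewrite /metric_density_comp.
have gE := metric_transition g cA dA cx dx.
have gU : g c (c x) \in unitmx by apply: metric_nondegenerate => //; exists x.
set J := jacobian _ _ in gE *.
have J0 : \det J != 0.
  apply/eqP => J0; move: gU; rewrite gE unitmxE !det_mulmx J0 !mul0r.
  by rewrite unitr0.
rewrite gE !det_mulmx det_tr mulrAC normrM normrM -expr2.
rewrite powRM ?exprn_ge0// mulrA -powR_mulrn// -powRrM -powRD ?normr_eq0 ?J0.
  by rewrite mulrN addrN powRr0 mul1r.
by rewrite implybT.
Qed.

Definition metric_density (M : manifold) (g : metric M) : density M 2 :=
  Density (@metric_density_transition M g).

Lemma mul_density_transition (M : manifold) (w : R) (f : M -> R)
    (t : density M w) c d :
  atlas c -> atlas d -> forall x, cdom c x -> cdom d x ->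
  f (param d (d x)) * t d (d x) =
    `|\det ('J (transition c d) (c x))| `^ (w / n.+1%:R) *
    (f (param c (c x)) * t c (c x)).
Proof.
move=> cA dA x cx dx.
by rewrite (density_transition t cA dA cx dx) !coordK// mulrCA.
Qed.

Definition mul_density (M : manifold) (w : R) (f : M -> R) (t : density M w) :
    density M w :=
  Density (dcomp := fun c u => f (param c u) * t c u)
    (@mul_density_transition M w f t).

End Manifolds.

(* [G] is the matrix of components of a metric in some chart. *)
Section LeviCivita.
Variables (R : realType) (n : nat) (G : 'rV[R]_n -> 'M[R]_n).
Implicit Types (u : 'rV[R]_n) (a b c d i j k l m : 'I_n) (w : R).

(* Gamma^c_ab *)
Definition christoffel u c a b : R :=
  2^-1 * \sum_d invmx (G u) c d *
    (pd a (fun v => G v b d) u + pd b (fun v => G v a d) u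
     - pd d (fun v => G v a b) u).

(* Weighted covariant tensors: nabla_a acts on the frame of E(w) used in
   [density] by (w/(n+1)) Gamma^d_ad.  Ordinary tensors have weight 0, and the
   first index of the result is the one of the derivative. *)
Definition nabla0 w (t : 'rV[R]_n -> R) u a : R :=
  pd a t u + w / n.+1%:R * (\sum_d christoffel u d a d) * t u.

Definition nabla1 w (t : 'rV[R]_n -> 'I_n -> R) u a b : R :=
  pd a (fun v => t v b) u
  - \sum_d christoffel u d a b * t u d
  + w / n.+1%:R * (\sum_d christoffel u d a d) * t u b.

Definition nabla2 w (t : 'rV[R]_n -> 'I_n -> 'I_n -> R) u a b c : R :=
  pd a (fun v => t v b c) u
  - \sum_d christoffel u d a b * t u d c
  - \sum_d christoffel u d a c * t u b d
  + w / n.+1%:R * (\sum_d christoffel u d a d) * t u b c.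

Definition hessian2 w (t : 'rV[R]_n -> R) := nabla1 w (nabla0 w t).
Definition hessian3 w (t : 'rV[R]_n -> R) := nabla2 w (hessian2 w t).

(* nabla_k v^j and nabla_l t_k^j *)
Definition nabla_vector (v : 'rV[R]_n -> 'I_n -> R) u k j : R :=
  pd k (fun u' => v u' j) u + \sum_m christoffel u j k m * v u m.

Definition nabla_mixed (t : 'rV[R]_n -> 'I_n -> 'I_n -> R) u l k j : R :=
  pd l (fun u' => t u' k j) u
  - \sum_m christoffel u m l k * t u m j
  + \sum_m christoffel u j l m * t u k m.

Definition coordinate_field i : 'rV[R]_n -> 'I_n -> R := fun _ j => (j == i)%:R.

(* R^j_ilk = ([nabla_l, nabla_k] v)^j for v the i-th coordinate field *)
Definition curvature u j i l k : R :=
  nabla_mixed (nabla_vector (coordinate_field i)) u l k j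
  - nabla_mixed (nabla_vector (coordinate_field i)) u k l j.

Definition ricci u j k : R := \sum_a curvature u a j a k.

Definition schouten u j k : R := (n%:R - 1)^-1 * ricci u j k.

Definition weyl u i j k l : R :=
  curvature u i j k l + (i == l)%:R * schouten u j k
  - (i == k)%:R * schouten u j l.

Definition in_nullity u (v : 'I_n -> R) : Prop :=
  forall i k l, \sum_j weyl u i j k l * v j = 0.

(* B^g is defined at [u] and equal to [b] there. *)
Definition is_Bg u (b : R) : Prop :=
  (exists2 v, in_nullity u v & exists i, v i != 0) /\
  forall v, in_nullity u v -> forall i,
    \sum_j (\sum_k invmx (G u) i k * schouten u k j) * v j = b * v i.

Definition grad (f : 'rV[R]_n -> R) u i : R :=
  \sum_j invmx (G u) i j * nabla0 0 f u j.

Definition sym3 (T : 'I_n -> 'I_n -> 'I_n -> R) a b c : R :=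
  6^-1 * (T a b c + T a c b + T b a c + T b c a + T c a b + T c b a).

(* nabla_a nabla_b nabla_c f
     + B0 (2 g_bc nabla_a f + g_ab nabla_c f + g_ca nabla_b f) *)
Definition GOT (B0 : R) (f : 'rV[R]_n -> R) u a b c : R :=
  hessian3 0 f u a b c
  + B0 * (2 * G u b c * nabla0 0 f u a + G u a b * nabla0 0 f u c
          + G u c a * nabla0 0 f u b).

(* nabla_(a nabla_b nabla_c) t + 4 B g_(ab nabla_c) t
     + 2 g_(ab (nabla_c) B) t, for t of weight 2 *)
Definition third_order_operator (B t : 'rV[R]_n -> R) u a b c : R :=
  sym3 (hessian3 2 t u) a b c
  + 4 * B u * sym3 (fun a' b' c' => G u a' b' * nabla0 2 t u c') a b c
  + 2 * sym3 (fun a' b' c' => G u a' b' * nabla0 0 B u c') a b c * t u.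

End LeviCivita.

(* The connection of [christoffel] is torsion free and metric. *)
Section LeviCivitaMetric.
Variables (R : realType) (n : nat) (M : manifold R n) (g : metric M).
Variables (c : chart R n M) (cA : atlas c) (u : 'rV[R]_n) (uc : cimg c u).

Lemma pd_metricC (a b d : 'I_n) :
  pd d (fun v => g c v a b) u = pd d (fun v => g c v b a) u.
Proof.
apply: near_eq_derive.
have : nbhs u (cimg c) by apply: open_nbhs_nbhs; split=> //; exact: cimg_open.
apply: filterS => v vc; have /matrixP/(_ b a) := metric_sym g cA vc.
by rewrite mxE.
Qed.

Lemma christoffelC (d a b : 'I_n) :
  christoffel (g c) u d a b = christoffel (g c) u d b a.
Proof.
rewrite /christoffel; congr (_ * _); apply: eq_bigr => e _.
by rewrite (pd_metricC a b) [X in X - _]addrC.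
Qed.

Lemma nabla_metric (a b d : 'I_n) : nabla2 (g c) 0 (g c) u a b d = 0.
Proof.
have low (i j k : 'I_n) : \sum_e christoffel (g c) u e i j * g c u e k =
    2^-1 * (pd i (fun v => g c v j k) u + pd j (fun v => g c v i k) u
            - pd k (fun v => g c v i j) u).
  under eq_bigr => e _ do rewrite /christoffel -mulrA.
  rewrite -mulr_sumr; congr (_ * _).
  under eq_bigr => e _ do rewrite mulr_suml.
  rewrite exchange_big/=.
  have gU := metric_nondegenerate g cA uc.
  transitivity (\sum_(l < n) (k == l)%:R *
      (pd i (fun v => g c v j l) u + pd j (fun v => g c v i l) u
            - pd l (fun v => g c v i j) u)); last first.
    rewrite (bigD1 k)//= eqxx mul1r big1 ?addr0// => l lk.
    by rewrite eq_sym (negbTE lk) mul0r.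
  apply: eq_bigr => l _.
  under eq_bigr => e _ do rewrite mulrAC.
  rewrite -mulr_suml; congr (_ * _).
  have /matrixP/(_ k l) := mulmxV gU; rewrite !mxE => <-.
  apply: eq_bigr => e _; rewrite mulrC.
  by have /matrixP/(_ k e) := metric_sym g cA uc; rewrite mxE => ->.
rewrite /nabla2 !mul0r addr0 low.
have -> : \sum_e christoffel (g c) u e a d * g c u b e =
    \sum_e christoffel (g c) u e a d * g c u e b.
  apply: eq_bigr => e _.
  by have /matrixP/(_ b e) := metric_sym g cA uc; rewrite mxE => ->.
by rewrite low (pd_metricC d b) (pd_metricC a d) (pd_metricC a b); field.
Qed.

End LeviCivitaMetric.

(* Main.v *)
(* At points where grad f <> 0, parts (i) and (ii) say that
   R^i_jkl f^j = B0 (delta^i_k f_l - delta^i_l f_k): nullity rewrites the left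
   side through the Schouten tensor, of which f^j is then an eigenvector with
   eigenvalue B0.  Conversely, lowering i makes R_ijkl skew in i and j, which
   forces one eigenvalue on the whole nullity.  Where grad f = 0 the identity is
   trivial, so it holds everywhere; by the Ricci identity it says that
   E_abc = nabla_a nabla_b nabla_c f
           + B0 (2 g_bc f_a + g_ab f_c + g_ca f_b)
   is symmetric in a and b.  As E is symmetric in b and c, it is then totally
   symmetric and vanishes if and only if its symmetrisation does.  The power of
   the volume density is parallel, so this symmetrisation is, up to that
   nonvanishing factor, the operator in (iii). *)
Require Import Defs.
From mathcomp Require Import all_boot all_order perm all_algebra.
From mathcomp Require Import all_classical all_reals all_analysis.
From mathcomp Require Import ring lra.
Import Order.TTheory GRing.Theory Num.Theory.
Import numFieldNormedType.Exports.
Local Open Scope classical_set_scope.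
Local Open Scope ring_scope.

Set Implicit Arguments.
Unset Strict Implicit.
Unset Printing Implicit Defensive.

(** * Algebra of the curvature at a point *)

(* [dg a i j], [dGam a i j k] and [ddg a b i j] stand for the partial derivatives
   d_a g_ij, d_a Gamma^i_jk and d_a d_b g_ij at a point, [C i j k l] for R^i_jkl. *)
Section PointwiseCurvature.
Variables (R : realFieldType) (n : nat).
Variables (g : 'I_n -> 'I_n -> R) (dg : 'I_n -> 'I_n -> 'I_n -> R).
Variables (Gam : 'I_n -> 'I_n -> 'I_n -> R).
Variables (dGam : 'I_n -> 'I_n -> 'I_n -> 'I_n -> R).
Implicit Types (a b d i j k l m p q : 'I_n).
Hypothesis gC : forall i j, g i j = g j i.
Hypothesis GamC : forall i j k, Gam i j k = Gam i k j.
Hypothesis dGamC : forall a i j k, dGam a i j k = dGam a i k j.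
Hypothesis dgE : forall a i j,
  dg a i j = \sum_d Gam d a i * g d j + \sum_d Gam d a j * g i d.

(** Coordinate formula for R^j_ilk, from nabla_k of the i-th coordinate field having components
    Gamma^j_ki. *)
Definition curv j i l k := dGam l j k i - dGam k j l i
  + (\sum_m Gam j l m * Gam m k i - \sum_m Gam j k m * Gam m l i).

(** Torsion-freeness makes the derivative terms, and likewise the quadratic ones, cancel in pairs
    over the cyclic sum. *)
Lemma curv_bianchi j i l k : curv j i l k + curv j l k i + curv j k i l = 0.
Proof.
rewrite /curv (dGamC l j k i) (dGamC k j l i) (dGamC i j k l).
have sumC a b d : \sum_m Gam j a m * Gam m b d = \sum_m Gam j a m * Gam m d b.
  by apply: eq_bigr => m _; rewrite (GamC m b).
by rewrite (sumC l k i) (sumC k l i) (sumC i k l); ring.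
Qed.

(** Koszul formula: in this combination of three metricity relations the symmetry of Gamma cancels
    all but two equal terms. *)
Lemma lower_Gam i j k :
  \sum_p g i p * Gam p j k = 2^-1 * (dg j k i + dg k j i - dg i j k).
Proof.
have swap x y z : \sum_d Gam d x y * g z d = \sum_d Gam d x y * g d z.
  by apply: eq_bigr => d _; rewrite (gC z).
have symm x y z : \sum_d Gam d x y * g d z = \sum_d Gam d y x * g d z.
  by apply: eq_bigr => d _; rewrite (GamC d x).
rewrite !dgE !swap (symm k j) (symm i j) (symm i k).
have -> : \sum_p g i p * Gam p j k = \sum_d Gam d j k * g d i.
  by apply: eq_bigr => d _; rewrite (gC i) mulrC.
by field.
Qed.

(** The inner product of nabla_a of the i-th and nabla_b of the j-th coordinate field. *)
Let quad i a j b := \sum_p \sum_q g p q * Gam q a i * Gam p b j.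

(** The left side is d_a of g_ip Gamma^p_bj. Metricity splits d_a g_ip in two: one part gives
    [quad], the other the product of Christoffel symbols occurring in the curvature. *)
Lemma d_lower_Gam i j a b :
  \sum_p (g i p * dGam a p b j + Gam p b j * dg a i p) =
  \sum_p g i p * dGam a p b j + quad i a j b
  + \sum_p g i p * \sum_m Gam p a m * Gam m b j.
Proof.
rewrite big_split/= -addrA; congr (_ + _).
transitivity (\sum_p (\sum_q g p q * Gam q a i * Gam p b j
     + \sum_q g i q * (Gam q a p * Gam p b j))).
  apply: eq_bigr => p _; rewrite dgE mulrDr !mulr_sumr.
  by congr (_ + _); apply: eq_bigr => q _; rewrite ?(gC q p); ring.
rewrite big_split/=; congr (_ + _).
by rewrite exchange_big; apply: eq_bigr => p _; rewrite mulr_sumr.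
Qed.

Lemma lower_curv i j l k :
  \sum_p g i p * curv p j l k =
    \sum_p (g i p * dGam l p k j + Gam p k j * dg l i p)
    - \sum_p (g i p * dGam k p l j + Gam p l j * dg k i p)
    - quad i l j k + quad i k j l.
Proof.
rewrite !d_lower_Gam /curv.
under eq_bigr do rewrite mulrDr !mulrBr.
by rewrite !big_split/= !sumrN; ring.
Qed.

Lemma quadC i j a b : quad i a j b = quad j b i a.
Proof.
rewrite /quad exchange_big; apply: eq_bigr => p _; apply: eq_bigr => q _.
by rewrite (gC q p); ring.
Qed.

Variable ddg : 'I_n -> 'I_n -> 'I_n -> 'I_n -> R.
Hypothesis ddgC : forall a b i j, ddg a b i j = ddg b a i j.
Hypothesis ddgs : forall a b i j, ddg a b i j = ddg a b j i.
(** The derivative d_a of the Koszul formula [lower_Gam]. *)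
Hypothesis ddgE : forall i j a b,
  \sum_p (g i p * dGam a p b j + Gam p b j * dg a i p) =
  2^-1 * (ddg a b j i + ddg a j b i - ddg a i b j).

(** Once the derivatives of Gamma are eliminated, R_ijlk consists of second derivatives of g and two
    [quad] terms. Exchanging i and j reverses the former because partial derivatives commute, the
    latter by [quadC]. *)
Lemma lower_curv_skew i j l k :
  \sum_p g i p * curv p j l k = - \sum_p g j p * curv p i l k.
Proof.
rewrite !lower_curv !ddgE (quadC j i l k) (quadC j i k l).
rewrite (ddgC l k j i) (ddgC l k i j) (ddgs k l i j) (ddgs k i l j).
rewrite (ddgs k j l i) (ddgs l i k j) (ddgs l j k i).
rewrite (ddgs k l j i).
by ring.
Qed.

Variables (dh : 'I_n -> R) (ddh : 'I_n -> 'I_n -> R).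
Variables (dddh : 'I_n -> 'I_n -> 'I_n -> R).
Hypothesis dddhC : forall a b c, dddh a b c = dddh b a c.

Let hess b c := ddh b c - \sum_d Gam d b c * dh d.

(** The Ricci identity for dh, with the derivative of the Hessian expanded by the product rule. The
    terms in second derivatives of h cancel crosswise, and the coefficients of dh assemble into the
    curvature. *)
Lemma hess_commutator a b c :
  (dddh a b c - \sum_d (Gam d b c * ddh a d + dh d * dGam a d b c)
   - \sum_d Gam d a b * hess d c - \sum_d Gam d a c * hess b d)
  - (dddh b a c - \sum_d (Gam d a c * ddh b d + dh d * dGam b d a c)
   - \sum_d Gam d b a * hess d c - \sum_d Gam d b c * hess a d)
  = - \sum_d curv d c a b * dh d.
Proof.
have E x y : \sum_d Gam d x c * hess y d = \sum_d Gam d x c * ddh y d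
    - \sum_d (\sum_m Gam d y m * Gam m x c) * dh d.
  rewrite /hess; under eq_bigr do rewrite mulrBr.
  rewrite sumrB; congr (_ - _).
  under eq_bigr do rewrite mulr_sumr.
  rewrite exchange_big; apply: eq_bigr => d _; rewrite mulr_suml.
  by apply: eq_bigr => m _; ring.
have symm : \sum_d Gam d b a * hess d c = \sum_d Gam d a b * hess d c.
  by apply: eq_bigr => d _; rewrite GamC.
have curvE : \sum_d curv d c a b * dh d =
    \sum_d dh d * dGam a d b c - \sum_d dh d * dGam b d a c
    + (\sum_d (\sum_m Gam d a m * Gam m b c) * dh d
       - \sum_d (\sum_m Gam d b m * Gam m a c) * dh d).
  by rewrite -!sumrB -big_split/=; apply: eq_bigr => d _; rewrite /curv; ring.
by rewrite !E symm curvE dddhC !big_split/=; ring.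
Qed.

End PointwiseCurvature.

(** * The projective Weyl nullity at a point *)

Section Nullity.
Variables (R : realFieldType) (n : nat).
Hypothesis n_ge2 : (2 <= n)%N.
Variables (g ginv : 'I_n -> 'I_n -> R).
Variables (C : 'I_n -> 'I_n -> 'I_n -> 'I_n -> R).
Implicit Types (v w : 'I_n -> R) (i j k l p : 'I_n) (B : R).
Hypothesis gC : forall i j, g i j = g j i.
Hypothesis ginvg : forall i j, \sum_k ginv i k * g k j = (i == j)%:R.
Hypothesis gginv : forall i j, \sum_k g i k * ginv k j = (i == j)%:R.
Hypothesis ginvC : forall i j, ginv i j = ginv j i.
Hypothesis C_skew : forall i j k l, C i j k l = - C i j l k.
Hypothesis C_bianchi : forall j i l k, C j i l k + C j l k i + C j k i l = 0.
Hypothesis C_lower : forall i j k l,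
  \sum_p g i p * C p j k l = - \sum_p g j p * C p i k l.

Let Ric j k := \sum_a C a j a k.
Let P j k := (n%:R - 1)^-1 * Ric j k.
Let W i j k l := C i j k l + (i == l)%:R * P j k - (i == k)%:R * P j l.
Let flat v k := \sum_j g k j * v j.
Definition nullity v := forall i k l, \sum_j W i j k l * v j = 0.

Lemma sum_delta (F : 'I_n -> R) i : \sum_j (i == j)%:R * F j = F i.
Proof.
rewrite (bigD1 i)//= eqxx mul1r big1 ?addr0// => j.
by rewrite eq_sym => /negbTE->; rewrite mul0r.
Qed.

Lemma ginv_lower (F : 'I_n -> R) i : \sum_k ginv i k * (\sum_p g k p * F p) = F i.
Proof.
transitivity (\sum_p (\sum_k ginv i k * g k p) * F p).
  under eq_bigr do rewrite mulr_sumr.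
  rewrite exchange_big; apply: eq_bigr => p _; rewrite mulr_suml.
  by apply: eq_bigr => k _; rewrite mulrA.
by under eq_bigr do rewrite ginvg; rewrite sum_delta.
Qed.

Lemma lower_ginv (F : 'I_n -> R) i : \sum_k g i k * (\sum_p ginv k p * F p) = F i.
Proof.
transitivity (\sum_p (\sum_k g i k * ginv k p) * F p).
  under eq_bigr do rewrite mulr_sumr.
  rewrite exchange_big; apply: eq_bigr => p _; rewrite mulr_suml.
  by apply: eq_bigr => k _; rewrite mulrA.
by under eq_bigr do rewrite gginv; rewrite sum_delta.
Qed.

(** The trace contracts R_ijkl, skew in i and j, with the symmetric inverse metric. *)
Lemma trace_curv k l : \sum_p C p p k l = 0.
Proof.
pose L i j := \sum_p g i p * C p j k l.
have E : \sum_p C p p k l = \sum_i \sum_j ginv i j * L j i.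
  by apply: eq_bigr => i _; rewrite ginv_lower.
suff skew : \sum_p C p p k l = - \sum_p C p p k l by lra.
rewrite {1}E exchange_big/= E -sumrN; apply: eq_bigr => i _.
rewrite -sumrN; apply: eq_bigr => j _.
by rewrite /L (C_lower i j) (ginvC j i) mulrN.
Qed.

(** Tracing the Bianchi identity turns the difference into the trace that vanishes by
    [trace_curv]. *)
Lemma RicC j k : Ric j k = Ric k j.
Proof.
suff E : Ric j k - Ric k j = - \sum_a C a a k j by rewrite trace_curv in E; lra.
rewrite /Ric -sumrB -sumrN; apply: eq_bigr => a _.
by have := C_bianchi a j a k; rewrite (C_skew a k j a); lra.
Qed.

Lemma PC j k : P j k = P k j.
Proof. by rewrite /P RicC. Qed.

(** The curvature acts on v as in a space of constant curvature B. This one identity encodes (i) and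
    (ii) where v is nonzero, and is trivial at v = 0. *)
Definition const_curv v B := forall i k l,
  \sum_j C i j k l * v j = B * ((i == k)%:R * flat v l - (i == l)%:R * flat v k).

(** Contract i with k: the first delta contributes n, the second 1, and n - 1 cancels the
    normalisation of [P]. *)
Lemma const_curv_schouten v B k : const_curv v B ->
  \sum_j P j k * v j = B * flat v k.
Proof.
move=> Cv; under eq_bigr do rewrite -mulrA.
rewrite -mulr_sumr; apply: (canLR (mulKf _)).
  by rewrite subr_eq0 pnatr_eq1; case: n n_ge2 => [|[|]].
transitivity (\sum_a \sum_j C a j a k * v j).
  rewrite exchange_big; apply: eq_bigr => j _.
  by rewrite mulr_suml.
under eq_bigr do rewrite Cv eqxx mul1r.
rewrite -mulr_sumr sumrB sumr_const card_ord.
under [X in _ - X]eq_bigr do rewrite eq_sym.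
rewrite (sum_delta (flat v)) -mulr_natl.
by ring.
Qed.

Let schv v k := \sum_j P j k * v j.

Lemma weyl_apply v i k l : \sum_j W i j k l * v j =
  \sum_j C i j k l * v j + (i == l)%:R * schv v k - (i == k)%:R * schv v l.
Proof.
rewrite /schv !mulr_sumr -!big_split/= -sumrB; apply: eq_bigr => j _.
by rewrite /W; ring.
Qed.

Lemma const_curv_nullity v B : const_curv v B -> nullity v.
Proof.
move=> Cv i k l; rewrite weyl_apply Cv /schv.
by rewrite !(const_curv_schouten _ Cv); ring.
Qed.

Lemma nullity_curv v i k l : nullity v ->
  \sum_j C i j k l * v j = (i == k)%:R * schv v l - (i == l)%:R * schv v k.
Proof. by move=> /(_ i k l); rewrite weyl_apply; lra. Qed.

(** Lowering an index is invertible; [PC] enters because [schv] contracts the first index of [P] and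
    the eigenvalue equation the second. *)
Lemma schouten_flat v B :
  (forall i, \sum_j (\sum_k ginv i k * P k j) * v j = B * v i) <->
  forall k, schv v k = B * flat v k.
Proof.
have E i : \sum_j (\sum_k ginv i k * P k j) * v j = \sum_k ginv i k * schv v k.
  under eq_bigr do rewrite mulr_suml.
  rewrite exchange_big; apply: eq_bigr => k _; rewrite mulr_sumr.
  by apply: eq_bigr => j _; rewrite (PC k) -mulrA.
split=> [Bv k|Bv i].
  rewrite -[LHS](lower_ginv (schv v)) /flat mulr_sumr; apply: eq_bigr => i _.
  by rewrite -E Bv mulrCA.
rewrite E; under eq_bigr do rewrite Bv mulrCA.
by rewrite -mulr_sumr ginv_lower.
Qed.

Lemma nullity_const_curv v B : nullity v ->
  (forall i, \sum_j (\sum_k ginv i k * P k j) * v j = B * v i) ->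
  const_curv v B.
Proof. by move=> Wv /schouten_flat Bv i k l; rewrite nullity_curv// !Bv; ring. Qed.

(** The contraction R_ijkl w^i v^j, on which skewness in i and j becomes skewness in w and v. *)
Let curv_form w v k l := \sum_i w i * \sum_p g i p * \sum_j C p j k l * v j.

Lemma curv_form_skew w v k l : curv_form w v k l = - curv_form v w k l.
Proof.
have E w' v' : curv_form w' v' k l = \sum_i \sum_j w' i * v' j * \sum_p g i p * C p j k l.
  apply: eq_bigr => i _; under [in RHS]eq_bigr do rewrite -mulrA.
  rewrite -mulr_sumr; congr (_ * _).
  under [in RHS]eq_bigr do rewrite mulr_sumr.
  rewrite exchange_big; apply: eq_bigr => p _; rewrite mulr_sumr.
  by apply: eq_bigr => j _; ring.
rewrite !E exchange_big/= -sumrN; apply: eq_bigr => i _.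
by rewrite -sumrN; apply: eq_bigr => j _; rewrite C_lower; ring.
Qed.

Lemma curv_form_nullity w v k l : nullity v ->
  curv_form w v k l = flat w k * schv v l - flat w l * schv v k.
Proof.
move=> Wv; rewrite /curv_form.
have E i : \sum_p g i p * \sum_j C p j k l * v j =
    g i k * schv v l - g i l * schv v k.
  under eq_bigr do rewrite nullity_curv// mulrBr !mulrA.
  rewrite sumrB -!mulr_suml.
  under eq_bigr do rewrite mulrC eq_sym.
  rewrite (sum_delta (g i)).
  under [X in _ - X * _]eq_bigr do rewrite mulrC eq_sym.
  by rewrite (sum_delta (g i)).
under eq_bigr do rewrite E mulrBr !mulrA.
rewrite sumrB -!mulr_suml.
by congr (_ * _ - _ * _); apply: eq_bigr => i _; rewrite mulrC gC.
Qed.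

(* A vector of the nullity that is not proportional to [v] has the same
   eigenvalue because [R_ijkl] is skew in its first two indices. *)
Lemma nullity_eigenvalue v B w : const_curv v B -> (exists i, v i != 0) ->
  nullity w ->
  forall i, \sum_j (\sum_k ginv i k * P k j) * w j = B * w i.
Proof.
move=> Cv [i0 vi0] Ww; apply/schouten_flat.
have Wv := const_curv_nullity Cv.
have Pv k : schv v k = B * flat v k := const_curv_schouten k Cv.
have flatK x i : \sum_k ginv i k * flat x k = x i by rewrite ginv_lower.
(* Lowering is injective, so the nonzero v has a nonzero lowered component, the pivot below. *)
have [m vm] : exists m, flat v m != 0.
  apply/existsP; apply: contraNT vi0 => /existsPn v0.
  rewrite -(flatK v) big1// => k _.
  by have := v0 k; rewrite negbK => /eqP->; rewrite mulr0.
have wv k l := curv_form_skew w v k l; have ww k l := curv_form_skew w w k l.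
have {}wv k l : flat v k * (schv w l - B * flat w l) =
    flat v l * (schv w k - B * flat w k).
  by have := wv k l; rewrite !curv_form_nullity// !Pv; lra.
have {}ww k l : flat w k * schv w l = flat w l * schv w k.
  by have := ww k l; rewrite !curv_form_nullity//; lra.
(* The defect of the eigenvalue equation for w. By [wv] it is proportional to flat v, so its pivot
   entry decides whether it vanishes. *)
pose r k := schv w k - B * flat w k.
suff r0 : r m = 0.
  move=> k; apply/eqP; rewrite -subr_eq0 -(mulrI_eq0 _ (lregP vm)).
  by rewrite (wv m k) -/(r m) r0 mulr0.
(* If the defect is nonzero, flat w and flat v are both multiples of it. Then w = x v, and the
   equation for v makes the defect vanish after all. *)
apply/eqP/negP => /negP rm.
pose x := flat w m / flat v m.
have wE k : flat w k = x * flat v k.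
  apply: (mulIf rm); rewrite /x.
  have -> : flat w k * r m = flat w m * r k.
    by rewrite /r; have := ww k m; lra.
  rewrite mulrAC -[RHS]mulrA [flat w m / _ * _]mulrC.
  have := wv m k; rewrite -/(r m) -/(r k) => vr.
  by apply: (mulIf vm); rewrite -mulrA [r k * _]mulrC vr; field.
have wi i : w i = x * v i.
  rewrite -[LHS]flatK -[v i]flatK mulr_sumr.
  by apply: eq_bigr => k _; rewrite wE mulrCA.
case/negP: rm; apply/eqP; rewrite /r wE mulrCA -Pv /schv mulr_sumr.
rewrite -sumrB big1// => j _; rewrite wi; ring.
Qed.

(** This is the form met in the Ricci identity, where the upper index is contracted with df.
    Skewness of R_ijkl moves v to the other slot at the cost of a sign; nondegeneracy gives the
    converse. *)
Lemma lower_const_curv v B : const_curv v B <->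
  forall c a b, \sum_d C d c a b * flat v d =
    - B * (g c a * flat v b - g c b * flat v a).
Proof.
have E c a b : \sum_d C d c a b * flat v d =
    - \sum_d g c d * \sum_e C d e a b * v e.
  transitivity (\sum_e (\sum_d g e d * C d c a b) * v e).
    rewrite /flat; under eq_bigr do rewrite mulr_sumr.
    rewrite exchange_big; apply: eq_bigr => e _; rewrite mulr_suml.
    by apply: eq_bigr => d _; rewrite (gC e d); ring.
  under eq_bigr do rewrite C_lower mulNr mulr_suml.
  rewrite sumrN exchange_big; congr (- _); apply: eq_bigr => d _.
  by rewrite mulr_sumr; apply: eq_bigr => e _; rewrite mulrA.
have D c a b : \sum_d g c d * ((d == a)%:R * flat v b - (d == b)%:R * flat v a) =
    g c a * flat v b - g c b * flat v a.
  rewrite -(sum_delta (g c) a) -(sum_delta (g c) b).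
  rewrite !mulr_suml -sumrB; apply: eq_bigr => d _.
  by rewrite (eq_sym a) (eq_sym b); ring.
split=> [Cv c a b|Cv i k l].
  rewrite E; under eq_bigr do rewrite Cv mulrCA.
  by rewrite -mulr_sumr D mulNr.
rewrite -[LHS](ginv_lower (fun i => \sum_j C i j k l * v j)).
under eq_bigr => c _.
  have -> : \sum_p g c p * \sum_j C p j k l * v j =
      B * \sum_d g c d * ((d == k)%:R * flat v l - (d == l)%:R * flat v k).
    by apply: oppr_inj; rewrite -E Cv D mulNr.
  rewrite mulrCA; over.
by rewrite -mulr_sumr ginv_lower.
Qed.

Section ThirdOrder.
Variables (T : 'I_n -> 'I_n -> 'I_n -> R) (v : 'I_n -> R) (B : R).
Hypothesis TC : forall a b c, T a b c = T a c b.
Hypothesis T_commutator : forall a b c,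
  T a b c - T b a c = - \sum_d C d c a b * flat v d.

Let E a b c := T a b c
  + B * (2 * g b c * flat v a + g a b * flat v c + g c a * flat v b).
Let S a b c := g a b * flat v c.
Let sym (F : 'I_n -> 'I_n -> 'I_n -> R) a b c :=
  6^-1 * (F a b c + F a c b + F b a c + F b c a + F c a b + F c b a).

(* Modulo the commutator and the symmetry of the Hessian, the tensor [E] of the
   Gallot-Obata-Tanno equation is totally symmetric, and its symmetrisation is
   the third-order operator. *)
Lemma third_order_equiv :
  (forall a b c, E a b c = 0) <->
  const_curv v B /\ forall a b c, sym T a b c + 4 * B * sym S a b c = 0.
Proof.
(* The metric terms of [E] share one symmetrisation and have coefficients 2 + 1 + 1 = 4. *)
have ST a b c : sym T a b c + 4 * B * sym S a b c = sym E a b c.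
  by rewrite /sym /E /S (gC a c) (gC b a) (gC c b); field.
split=> [E0|[/lower_const_curv Cv S0] a b c].
  split=> [|a b c]; last by rewrite ST /sym !E0; ring.
  apply/lower_const_curv => c a b; have := T_commutator a b c.
  have := E0 a b c; have := E0 b a c; rewrite /E (gC b a) (gC a c) (gC b c).
  by lra.
have EC x y z : E x y z = E x z y.
  by rewrite /E TC (gC z y) (gC x y) (gC x z); ring.
have EC' x y z : E x y z = E y x z.
  have := T_commutator x y z; rewrite Cv /E (gC y x) (gC x z) (gC z y); lra.
(* By the two symmetries all six terms of the symmetrisation equal [E a b c]. *)
have := S0 a b c; rewrite ST /sym (EC a c b) -(EC' a b c) (EC b c a) -(EC' a b c).
rewrite (EC' c a b) (EC' c b a) (EC b c a) -(EC' a b c) (EC a c b); lra.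
Qed.

End ThirdOrder.

End Nullity.

(** * Partial derivatives *)

Section PartialDerivatives.
Variables (R : realType) (n : nat).
Implicit Types (U : set 'rV[R]_n) (F G : 'rV[R]_n -> R) (a b : 'I_n).
Implicit Types (u v w : 'rV[R]_n) (r s t : R).

Notation e_ a := (delta_mx 0 a : 'rV[R]_n).

Record pderivable a F u : Prop := PDerivable {
  pderivableP :> derivable (F : _ -> R^o) u (e_ a) }.

Lemma pd_translate a F w u : pd a (fun v => F (w + v)) u = pd a F (w + u).
Proof.
rewrite /pd /derive /=.
by under eq_fun do rewrite addrCA.
Qed.

Lemma pderivable_translate a F w u :
  pderivable a F (w + u) -> pderivable a (fun v => F (w + v)) u.
Proof.
case=> dF; split; move: dF; rewrite /derivable /=.
by under [X in _ -> cvg (X @ _)]eq_fun do rewrite addrCA.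
Qed.

Lemma is_derive_line a F u s : pderivable a F (s *: e_ a + u) ->
  is_derive s 1 (fun r => F (r *: e_ a + u) : R^o) (pd a F (s *: e_ a + u)).
Proof.
case=> dF; have E : (fun h : R => h^-1 *: (((fun r => F (r *: e_ a + u) : R^o)
     \o shift s) (h *: (1 : R)) - F (s *: e_ a + u))) =
   (fun h : R => h^-1 *: (((F : _ -> R^o) \o shift (s *: e_ a + u)) (h *: e_ a)
     - F (s *: e_ a + u))).
  by apply/funext => h /=; rewrite [_%:A]mulr1 scalerDl addrA.
by split; rewrite /derivable /derive E.
Qed.

(** The one-variable mean value theorem on a line; t may be negative, hence the bound on the
    absolute value of s. *)
Lemma mean_value_line a F u t :
  (forall s, `|s| <= `|t| -> pderivable a F (s *: e_ a + u)) ->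
  exists2 s, `|s| <= `|t| &
    F (t *: e_ a + u) - F u = t * pd a F (s *: e_ a + u).
Proof.
move=> dF; pose phi r := F (r *: e_ a + u); pose dphi r := pd a F (r *: e_ a + u).
have phiE r : `|r| <= `|t| -> is_derive r 1 (phi : R -> R^o) (dphi r).
  by move=> /dF; exact: is_derive_line.
have cphi (x y : R) : (forall r, r \in `[x, y]%R -> `|r| <= `|t|) ->
    {within `[x, y], continuous phi}.
  move=> xy; apply: (@derivable_within_continuous R R^o) => r /xy rt.
  by have [] := phiE _ rt.
have phi0 : phi 0 = F u by rewrite /phi scale0r add0r.
rewrite -phi0 -/(phi t); have [t0|t0] := leP 0 t.
  have small r : r \in `[0, t]%R -> `|r| <= `|t|.
    by rewrite in_itv/= => /andP[r0 rt]; rewrite !ger0_norm.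
  have [||s st ->] := MVT_segment t0 (f := phi) (df := dphi).
  - by move=> r rt; apply: phiE; apply: small; exact: subset_itv_oo_cc.
  - exact: cphi.
  - by exists s; [exact: small|rewrite subr0 mulrC].
have small r : r \in `[t, 0]%R -> `|r| <= `|t|.
  by rewrite in_itv/= => /andP[r0 rt]; rewrite (ltr0_norm t0) ler0_norm// lerN2.
have [||s st E] := MVT_segment (ltW t0) (f := phi) (df := dphi).
- by move=> r rt; apply: phiE; apply: small; exact: subset_itv_oo_cc.
- exact: cphi.
- by exists s; [exact: small|rewrite -opprB E sub0r mulrN opprK mulrC].
Qed.

Lemma near_dist_lt F u (e : R) : {for u, continuous F} -> 0 < e ->
  \forall v \near u, `|F u - F v| < e.
Proof. by move=> cF e0; have /cvgrPdist_lt := cF; exact. Qed.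

Lemma near_line u a (P : set 'rV[R]_n) :
  (\forall v \near u, P v) -> \forall h \near (0 : R), P (h *: e_ a + u).
Proof.
move=> /nbhs0P P0; apply: (near0Z (e_ a) (P := fun v => P (v + u))).
by apply: filterS P0 => v; rewrite addrC.
Qed.

Lemma near_eq_pd a F G u : (\forall v \near u, F v = G v) -> pd a F u = pd a G u.
Proof. by move=> FG; rewrite /pd; apply: near_eq_derive. Qed.

Lemma near_eq_pderivable a F G u : (\forall v \near u, F v = G v) ->
  pderivable a F u -> pderivable a G u.
Proof. by move=> FG [dF]; split; exact: near_eq_derivable dF. Qed.

Lemma pd_cst a (k : R) u : pd a (fun=> k) u = 0.
Proof. exact: derive_cst. Qed.

Lemma pderivable_cst a (k : R) u : pderivable a (fun=> k) u.
Proof. by split; exact: derivable_cst. Qed.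

Lemma pdD a F G u : pderivable a F u -> pderivable a G u ->
  pd a (fun v => F v + G v) u = pd a F u + pd a G u.
Proof. by move=> [dF] [dG]; exact: (deriveD dF dG). Qed.

Lemma pderivableD a F G u : pderivable a F u -> pderivable a G u ->
  pderivable a (fun v => F v + G v) u.
Proof. by move=> [dF] [dG]; split; exact: (derivableD dF dG). Qed.

Lemma pdB a F G u : pderivable a F u -> pderivable a G u ->
  pd a (fun v => F v - G v) u = pd a F u - pd a G u.
Proof. by move=> [dF] [dG]; exact: (deriveB dF dG). Qed.

Lemma pderivableB a F G u : pderivable a F u -> pderivable a G u ->
  pderivable a (fun v => F v - G v) u.
Proof. by move=> [dF] [dG]; split; exact: (derivableB dF dG). Qed.

Lemma pdM a F G u : pderivable a F u -> pderivable a G u ->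
  pd a (fun v => F v * G v) u = F u * pd a G u + G u * pd a F u.
Proof. by move=> [dF] [dG]; exact: (deriveM dF dG). Qed.

Lemma pderivableM a F G u : pderivable a F u -> pderivable a G u ->
  pderivable a (fun v => F v * G v) u.
Proof. by move=> [dF] [dG]; split; exact: (derivableM dF dG). Qed.

Lemma pdZ a F (k : R) u : pderivable a F u ->
  pd a (fun v => k * F v) u = k * pd a F u.
Proof. by move=> [dF]; exact: deriveZ. Qed.

Lemma pderivableZ a F (k : R) u : pderivable a F u ->
  pderivable a (fun v => k * F v) u.
Proof. by move=> [dF]; split; exact: derivableZ. Qed.

Lemma pderivableV a F u : F u != 0 -> pderivable a F u ->
  pderivable a (fun v => (F v)^-1) u.
Proof. by move=> F0 [dF]; split; exact: derivableV. Qed.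

(** Two mean value theorems: in direction a for the increment [H] of F in direction b, then in
    direction b for [pd a F]. *)
Lemma second_difference a b F u t :
  (forall s1 s2, `|s1| <= `|t| -> `|s2| <= `|t| ->
     pderivable a F (s1 *: e_ a + (s2 *: e_ b + u)) /\
     pderivable b (pd a F) (s2 *: e_ b + (s1 *: e_ a + u))) ->
  exists s1 s2, [/\ `|s1| <= `|t|, `|s2| <= `|t| &
    F (t *: e_ b + (t *: e_ a + u)) - F (t *: e_ a + u) - F (t *: e_ b + u) + F u
    = t * (t * pd b (pd a F) (s2 *: e_ b + (s1 *: e_ a + u)))].
Proof.
move=> dF; pose H v := F (t *: e_ b + v) - F v.
have dFt s : `|s| <= `|t| -> pderivable a F (t *: e_ b + (s *: e_ a + u)).
  by move=> st; rewrite (addrCA (t *: _)); have [] := dF s t st (lexx `|t|).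
have dF0 s : `|s| <= `|t| -> pderivable a F (s *: e_ a + u).
  move=> st; have [|+ _] := dF s 0 st; first by rewrite normr0.
  by rewrite scale0r add0r.
have [s st|s1 s1t E1] := @mean_value_line a H u t.
  by apply: pderivableB; [exact/pderivable_translate/dFt|exact: dF0].
have [s st|s2 s2t E2] := @mean_value_line b (pd a F) (s1 *: e_ a + u) t.
  by have [] := dF s1 s s1t st.
exists s1, s2; split=> //.
transitivity (H (t *: e_ a + u) - H u); first by rewrite /H; ring.
rewrite E1 -E2; congr (_ * _); rewrite pdB; last 2 first.
- exact/pderivable_translate/dFt.
- exact: dF0.
by rewrite pd_translate.
Qed.

Lemma close_dist (x y p q e : R) :
  p = q -> `|y - p| < e / 2 -> `|x - q| < e / 2 -> `|x - y| <= e.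
Proof.
move=> -> yq xq; rewrite ltW// (splitr e) (le_lt_trans _ (ltrD xq yq))//.
by rewrite (distrC y) (le_trans _ (ler_normD _ _))// addrA subrK.
Qed.

(** Schwarz's theorem. The second difference is symmetric in the two directions, so the mixed
    derivatives agree at some pair of points near u; continuity transfers this to u up to any e. *)
Lemma pdC U F a b u : open U -> class_C 2 U F -> U u ->
  pd a (pd b F) u = pd b (pd a F) u.
Proof.
move=> oU [_ C2] Uu.
have dF c v : U v -> pderivable c F v.
  by move=> Uv; split; have [+ _] := C2 c; apply.
have C1 c d v : U v -> pderivable d (pd c F) v.
  by move=> Uv; split; have [_ [_ /(_ d)[+ _]]] := C2 c; apply.
have cont c d : {for u, continuous (pd d (pd c F))}.
  by have [_ [_ /(_ d)[_ [+ _]]]] := C2 c; apply.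
apply/eqP; rewrite -subr_eq0 -normr_le0; apply/ler_addgt0Pr => e e0.
rewrite add0r; have e20 : 0 < e / 2 by rewrite divr_gt0.
have : \forall v \near u, [/\ U v, `|pd a (pd b F) u - pd a (pd b F) v| < e / 2 &
    `|pd b (pd a F) u - pd b (pd a F) v| < e / 2].
  have Uu' : \forall v \near u, U v by exact: open_nbhs_nbhs.
  have cab := near_dist_lt (cont b a) e20.
  have cba := near_dist_lt (cont a b) e20.
  by move: Uu' cab cba; apply: filterS3.
(* Two displacements of size at most r / 3 stay together inside the ball of radius r. *)
move=> /nbhs_ballP[r /= r0 rW]; pose t := r / 3.
have t0 : 0 < t by rewrite divr_gt0.
have tW c d (s1 s2 : R) : `|s1| <= `|t| -> `|s2| <= `|t| ->
    ball u r (s2 *: e_ d + (s1 *: e_ c + u)).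
  rewrite (gtr0_norm t0) => s1t s2t; split=> // i j; rewrite !ord1 !mxE eqxx/=.
  rewrite /ball/= addrA opprD addrCA subrr addr0 normrN.
  rewrite (le_lt_trans (ler_normD _ _))// !normrM.
  have small (x : R) (B : bool) : `|x| <= t -> `|x| * `|B%:R| <= t.
    by case: B => xt; rewrite ?normr1 ?normr0 ?mulr1// mulr0 ltW.
  rewrite (le_lt_trans (lerD (small _ _ s2t) (small _ _ s1t)))//.
  by rewrite /t; lra.
have [s1 s2 s1t s2t|x1 [x2 [x1t x2t E1]]] := @second_difference a b F u t.
  split; first by apply: dF; have [] := rW _ (tW b a _ _ s2t s1t).
  by apply: C1; have [] := rW _ (tW a b _ _ s1t s2t).
have [s1 s2 s1t s2t|y1 [y2 [y1t y2t E2]]] := @second_difference b a F u t.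
  split; first by apply: dF; have [] := rW _ (tW a b _ _ s2t s1t).
  by apply: C1; have [] := rW _ (tW b a _ _ s1t s2t).
have [_ _ X] := rW _ (tW a b _ _ x1t x2t).
have [_ Y _] := rW _ (tW b a _ _ y1t y2t).
have /(mulfI (lt0r_neq0 t0))/(mulfI (lt0r_neq0 t0)) XY :
    t * (t * pd b (pd a F) (x2 *: e_ b + (x1 *: e_ a + u))) =
    t * (t * pd a (pd b F) (y2 *: e_ a + (y1 *: e_ b + u))).
  have FE : F (t *: e_ b + (t *: e_ a + u)) = F (t *: e_ a + (t *: e_ b + u)).
    by congr F; exact: addrCA.
  by apply: etrans (esym E1) (etrans _ E2); rewrite FE; congr (_ + _); exact: addrAC.
exact: close_dist XY X Y.
Qed.

(** Near u all partial derivatives are below eps, and the mean value theorem applies along each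
    coordinate segment of a path from u to v. This plays the part of total differentiability at a
    critical point. *)
Lemma critical_increment U F u (eps : R) : open U -> class_C 1 U F -> U u ->
  (forall a, pd a F u = 0) -> 0 < eps ->
  \forall v \near u, `|F v - F u| <= eps * \sum_i `|v 0 i - u 0 i|.
Proof.
move=> oU [_ C1] Uu F0 eps0.
have : \forall v \near u, U v /\ forall a, `|pd a F v| < eps.
  apply: filterI; first exact: open_nbhs_nbhs.
  apply: (@filter_forall _ _ (fun a v => `|pd a F v| < eps) _
    (nbhs_filter u)) => a.
  have [_ [/(_ u Uu) cF _]] := C1 a.
  have := near_dist_lt cF eps0; apply: filterS => v; rewrite F0 sub0r normrN.
  by [].
move=> /nbhs_ballP[r /= r0 rU]; apply/nbhs_ballP; exists r => //= v uv.
(* [p] changes [u] into [v] one coordinate at a time. *)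
pose p k : 'rV[R]_n := \row_i (if (i < k)%N then v 0 i else u 0 i).
have -> : F v = F (p n) by congr F; apply/rowP => i; rewrite mxE ltn_ord.
have -> : F u = F (p 0%N) by congr F; apply/rowP => i; rewrite mxE.
rewrite -(telescope_sumr (fun k => F (p k)) (leq0n n)) big_mkord.
rewrite (le_trans (ler_norm_sum _ _ _))//.
rewrite mulr_sumr; apply: ler_sum => i _.
(* The ball is a box, so it contains every point mixing coordinates of u and v. *)
have pS s : `|s| <= `|v 0 i - u 0 i| -> U (s *: e_ i + p i) /\
    forall a, `|pd a F (s *: e_ i + p i)| < eps.
  move=> sv; apply: rU; split=> // k j; rewrite !ord1 !mxE eqxx/=.
  have [->|ji] := eqVneq j i.
    rewrite mulr1 ltnn /ball/= opprD addrCA subrr addr0 normrN.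
    by rewrite (le_lt_trans sv)// distrC; exact: (uv.2 0 i).
  rewrite mulr0 add0r; case: ifP => _; first exact: (uv.2 0 j).
  by rewrite /ball/= subrr normr0.
have -> : p i.+1 = (v 0 i - u 0 i) *: e_ i + p i.
  apply/rowP => j; rewrite !mxE eqxx/= ltnS leq_eqVlt.
  have [->|ji] := eqVneq j i; first by rewrite eqxx ltnn/= mulr1 subrK.
  by rewrite (negbTE (_ : _ != _ :> nat))//= mulr0 add0r.
have [s sv|s sv ->] := @mean_value_line i F (p i) (v 0 i - u 0 i).
  by split; have [+ _] := C1 i; apply; have [] := pS s sv.
by rewrite normrM mulrC ler_wpM2r// ltW//; have [_] := pS s sv; exact.
Qed.

End PartialDerivatives.

(** The chain rule at a critical point of F: increments of F are of smaller order than those of phi,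
    whose difference quotients stay bounded. *)
Lemma pd_comp_critical (R : realType) (m n : nat) (V : set 'rV[R]_n)
    (F : 'rV[R]_n -> R) (phi : 'rV[R]_m -> 'rV[R]_n) (u : 'rV[R]_m) a :
  open V -> class_C 1 V F -> V (phi u) -> (forall b, pd b F (phi u) = 0) ->
  (forall b, {for u, continuous (fun v => phi v 0 b)}) ->
  (forall b, pderivable a (fun v => phi v 0 b) u) ->
  pd a (F \o phi) u = 0.
Proof.
move=> oV C1 Vu F0 cphi dphi.
pose D (i : 'I_n) := pd a (fun v => phi v 0 i) u.
(* Eventually bounds the sum of the difference quotients of the components of phi; below, eps is
   divided by C + 1 because C may be 0. *)
pose C := \sum_i (`|D i| + 1).
have C0 : 0 <= C by apply: sumr_ge0 => i _; rewrite addr_ge0.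
rewrite /pd /derive; apply/cvg_lim => //; apply/cvgr0Pnorm_le => eps eps0.
have e0 : 0 < eps / (C + 1) by rewrite divr_gt0// ltr_wpDl.
have near_phi (P : set 'rV[R]_n) : (\forall v \near phi u, P v) ->
    \forall v \near u, P (phi v).
  move=> /nbhs_ballP[r /= r0 rP].
  have : \forall v \near u, forall i, `|phi u 0 i - phi v 0 i| < r.
    apply: (@filter_forall _ _ (fun i v => `|phi u 0 i - phi v 0 i| < r) _
      (nbhs_filter u)) => i.
    exact: near_dist_lt (cphi i) r0.
  apply: filterS => v phiv; apply: rP; split=> // i j.
  by rewrite !ord1; exact: phiv.
have : \forall h \near 0^', `|F (phi (h *: delta_mx 0 a + u)) - F (phi u)|
    <= eps / (C + 1) *
       \sum_i `|phi (h *: delta_mx 0 a + u) 0 i - phi u 0 i|.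
  apply: (@cvg_within _ (nbhs (0 : R))).
  exact: near_line (near_phi _ (critical_increment oV C1 Vu F0 e0)).
have : \forall h \near 0^', forall i,
    `|h^-1 * (phi (h *: delta_mx 0 a + u) 0 i - phi u 0 i)| <= `|D i| + 1.
  apply: (@filter_forall _ _ (fun i h =>
    `|h^-1 * (phi (h *: delta_mx 0 a + u) 0 i - phi u 0 i)| <= `|D i| + 1) _
    (dnbhs_filter 0)) => i.
  have /cvg_norm Di := pderivableP (dphi i).
  have := cvgr_le _ Di; apply; by rewrite ltrDl.
apply: filterS2 => h hD hF /=; rewrite normrZ.
rewrite (le_trans (ler_wpM2l _ hF))// mulrCA mulr_sumr.
rewrite (_ : \sum_i _ = \sum_i
  `|h^-1 * (phi (h *: delta_mx 0 a + u) 0 i - phi u 0 i)|); last first.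
  by apply: eq_bigr => i _; rewrite normrM.
rewrite mulrAC ler_pdivrMr ?ltr_wpDl//; apply: ler_wpM2l; first exact: ltW.
have CE : \sum_i `|h^-1 * (phi (h *: delta_mx 0 a + u) 0 i - phi u 0 i)| <= C.
  by apply: ler_sum.
by rewrite (le_trans CE)// lerDl.
Qed.

(** * Derivatives of sums, products, determinants and compositions *)

Section PartialDerivativeRules.
Variables (R : realType) (n : nat).
Implicit Types (F : 'rV[R]_n -> R) (a : 'I_n) (u v : 'rV[R]_n).

Lemma pd_sumE (I : Type) (r : seq I) a (F : I -> 'rV[R]_n -> R) u :
  (forall i, pderivable a (F i) u) ->
  pderivable a (fun v => \sum_(i <- r) F i v) u /\
  pd a (fun v => \sum_(i <- r) F i v) u = \sum_(i <- r) pd a (F i) u.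
Proof.
move=> dF; elim: r => [|i r [dr IH]].
  under [fun v => _]eq_fun do rewrite big_nil.
  by rewrite big_nil pd_cst; split=> //; exact: pderivable_cst.
under [fun v => _]eq_fun do rewrite big_cons.
by rewrite big_cons pdD// IH; split=> //; exact: pderivableD.
Qed.

Lemma pd_sum (I : Type) (r : seq I) a (F : I -> 'rV[R]_n -> R) u :
  (forall i, pderivable a (F i) u) ->
  pd a (fun v => \sum_(i <- r) F i v) u = \sum_(i <- r) pd a (F i) u.
Proof. by move=> dF; have [] := pd_sumE r dF. Qed.

Lemma pderivable_sum (I : Type) (r : seq I) a (F : I -> 'rV[R]_n -> R) u :
  (forall i, pderivable a (F i) u) ->
  pderivable a (fun v => \sum_(i <- r) F i v) u.
Proof. by move=> dF; have [] := pd_sumE r dF. Qed.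

Lemma pd_prodE m a (F : 'I_m -> 'rV[R]_n -> R) u :
  (forall i, pderivable a (F i) u) ->
  pderivable a (fun v => \prod_i F i v) u /\
  pd a (fun v => \prod_i F i v) u =
    \sum_i \prod_j (if j == i then pd a (F j) u else F j u).
Proof.
elim: m F => [F _|m IH F dF].
  under [fun v => _]eq_fun do rewrite big_ord0.
  by rewrite big_ord0 pd_cst; split=> //; exact: pderivable_cst.
have [dP PE] := IH (fun i => F (lift ord0 i)) (fun i => dF _).
under [fun v => _]eq_fun do rewrite big_ord_recl.
split; first exact: pderivableM.
rewrite pdM// PE [RHS]big_ord_recl addrC mulrC; congr (_ + _).
  by rewrite big_ord_recl eqxx.
rewrite mulr_sumr; apply: eq_bigr => i _; rewrite big_ord_recl.
by congr (_ * _); apply: eq_bigr => j _; rewrite (inj_eq lift_inj).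
Qed.

Lemma pd_detE m a (A : 'rV[R]_n -> 'M[R]_m) u :
  (forall i j, pderivable a (fun v => A v i j) u) ->
  pderivable a (fun v => \det (A v)) u /\
  pd a (fun v => \det (A v)) u =
    \sum_i \sum_j pd a (fun v => A v i j) u * cofactor (A u) i j.
Proof.
move=> dA; rewrite /determinant.
have dP (s : {perm 'I_m}) := pd_prodE (fun i => dA i (s i)).
have dT (s : {perm 'I_m}) : pderivable a (fun v => (-1) ^+ s * \prod_i A v i (s i)) u.
  by apply: pderivableZ; have [] := dP s.
split; first exact: pderivable_sum.
rewrite pd_sum//.
under eq_bigr => s _.
  rewrite pdZ; last by have [] := dP s.
  rewrite (dP s).2 mulr_sumr; over.
rewrite exchange_big/=; apply: eq_bigr => i _.
(* A with its row i differentiated; expanding along that row leaves the cofactors of A. *)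
pose B := \matrix_(k, j) (if k == i then pd a (fun v => A v k j) u else A u k j).
transitivity (\det B).
  apply: eq_bigr => s _; congr (_ * _); apply: eq_bigr => k _.
  by rewrite mxE.
rewrite (expand_det_row _ i); apply: eq_bigr => j _; rewrite mxE eqxx.
congr (_ * (_ * \det _)); apply/matrixP => k l.
by rewrite !mxE eq_sym (negbTE (neq_lift _ _)).
Qed.

Lemma pderivable_det m a (A : 'rV[R]_n -> 'M[R]_m) u :
  (forall i j, pderivable a (fun v => A v i j) u) ->
  pderivable a (fun v => \det (A v)) u.
Proof. by move=> /pd_detE[]. Qed.

(** Jacobi's formula: the cofactors are the determinant times the entries of the inverse. *)
Lemma pd_det m a (A : 'rV[R]_n -> 'M[R]_m) u :
  A u \in unitmx -> (forall i j, pderivable a (fun v => A v i j) u) ->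
  pd a (fun v => \det (A v)) u =
    \det (A u) * \sum_i \sum_j invmx (A u) i j * pd a (fun v => A v j i) u.
Proof.
move=> Au /pd_detE[_ ->]; rewrite exchange_big mulr_sumr; apply: eq_bigr => i _.
rewrite mulr_sumr; apply: eq_bigr => j _.
rewrite /invmx Au !mxE -[_^-1 * _ * _]mulrA mulVKf 1?mulrC//.
by rewrite -unitfE -unitmxE.
Qed.

Lemma pderivable_invmx m a (A : 'rV[R]_n -> 'M[R]_m) u i j :
  (\forall v \near u, A v \in unitmx) ->
  (forall k l, pderivable a (fun v => A v k l) u) ->
  pderivable a (fun v => invmx (A v) i j) u.
Proof.
move=> Au dA.
(* The cofactor formula is available only near u, since [invmx] returns a singular matrix
   unchanged. *)
apply: (near_eq_pderivable (F := fun v => (\det (A v))^-1 * cofactor (A v) j i)).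
  by apply: filterS Au => v vu; rewrite /invmx vu !mxE.
apply: pderivableM.
  apply: pderivableV; last exact: pderivable_det.
  by rewrite -unitfE -unitmxE; exact: nbhs_singleton Au.
apply: pderivableZ; apply: pderivable_det => k l.
under [fun v => _]eq_fun do rewrite !mxE.
exact: dA.
Qed.

Lemma pd_comp a F (phi : R -> R) u (d : R) :
  pderivable a F u -> is_derive (F u) 1 (phi : R -> R^o) d ->
  pderivable a (fun v => phi (F v)) u /\
  pd a (fun v => phi (F v)) u = d * pd a F u.
Proof.
pose L (G : 'rV[R]_n -> R) := fun r : R => G (r *: delta_mx 0 a + u) : R^o.
have L0 : L F 0 = F u by rewrite /L scale0r add0r.
have LE G : (fun h : R => h^-1 *: ((L G \o shift 0) (h *: (1 : R)) - L G 0)) =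
   (fun h : R => h^-1 *: (((G : _ -> R^o) \o shift u) (h *: delta_mx 0 a) - G u)).
  by apply/funext => h /=; rewrite [_%:A]mulr1 addr0 /L scale0r add0r.
have dL G : derivable (G : _ -> R^o) u (delta_mx 0 a) = derivable (L G) 0 1.
  by rewrite /derivable LE.
have pdL G : pd a G u = derive1 (L G) 0 by rewrite derive1E /pd /derive LE.
move=> [dF] [dphi <-]; rewrite -derive1E -L0.
have dLF : derivable (L F) 0 1 by rewrite -dL; exact: dF.
have dphiL : derivable (phi : R -> R^o) (L F 0) 1 by rewrite L0; exact: dphi.
split; last by rewrite !pdL; exact: (derive1_comp dLF dphiL).
have /derivable1_diffP D1 := dLF; have /derivable1_diffP D2 := dphiL.
by split; rewrite dL; apply/derivable1_diffP; exact: (differentiable_comp D1 D2).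
Qed.

Lemma pd_powR_det m a (A : 'rV[R]_n -> 'M[R]_m) u (p : R) :
  A u \in unitmx -> (forall i j, pderivable a (fun v => A v i j) u) ->
  let D v := `|\det (A v)| `^ p in
  pderivable a D u /\ pd a D u =
    p * D u * \sum_i \sum_j invmx (A u) i j * pd a (fun v => A v j i) u.
Proof.
(* The squared determinant is positive at u and differentiable, so (det^2)^(p/2) avoids
   differentiating an absolute value. *)
move=> Au dA D; pose q v := \det (A v) * \det (A v).
have det0 : \det (A u) != 0 by rewrite -unitfE -unitmxE.
have q0 : 0 < q u by rewrite /q -expr2 exprn_even_gt0.
have dd : pderivable a (fun v => \det (A v)) u by exact: pderivable_det.
have DE : D = (fun v => (q v) `^ (p / 2)).
  apply/funext => v; rewrite /D /q -expr2 -real_normK ?num_real//.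
  by rewrite -powR_mulrn// -powRrM mulrC divfK.
have [|dD] := @pd_comp a q (fun x => x `^ (p / 2)) u _ _ (is_derive1_powR _ q0).
  exact: pderivableM.
set S := \sum_i _; have qE : pd a q u = 2 * (q u * S).
  by rewrite (pdM dd dd) pd_det// -/S /q; ring.
rewrite -DE => dDE; split; first by rewrite DE; exact: dD.
rewrite dDE qE.
rewrite DE powRB ?(gt_eqF q0) ?implybT// powRr1 ?ltW//.
by field; rewrite gt_eqF.
Qed.

End PartialDerivativeRules.

(** * Levi-Civita connection in a chart *)

Section ChartGeometry.
Variables (R : realType) (n : nat) (M : manifold R n) (g : metric M).
Variables (c : chart R n M) (cA : atlas c).
Implicit Types (u v : 'rV[R]_n) (a b d i j k l m p q : 'I_n).
Implicit Types (h : 'rV[R]_n -> R).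

Notation G := (g c).
Notation Gam := (christoffel (g c)).

Lemma near_cimg u : cimg c u -> \forall v \near u, cimg c v.
Proof. by move=> uc; apply: open_nbhs_nbhs; split=> //; exact: cimg_open. Qed.

Lemma smooth_pderivable h u a :
  smooth_on (cimg c) h -> cimg c u -> pderivable a h u.
Proof. by move=> /(_ 1%N)[_ /(_ a)[dh _]] uc; split; exact: dh. Qed.

Lemma smooth_pd h a : smooth_on (cimg c) h -> smooth_on (cimg c) (pd a h).
Proof. by move=> sh k; have [_ /(_ a)[_]] := sh k.+1. Qed.

Lemma smooth_pdC h u a b : smooth_on (cimg c) h -> cimg c u ->
  pd a (pd b h) u = pd b (pd a h) u.
Proof. by move=> sh uc; apply: pdC (sh 2%N) uc; exact: cimg_open. Qed.

Lemma pderivable_metric u a i j :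
  cimg c u -> pderivable a (fun v => G v i j) u.
Proof. by move=> uc; exact: smooth_pderivable (metric_smooth g cA i j) uc. Qed.

Lemma pderivable_pd_metric u a b i j :
  cimg c u -> pderivable a (pd b (fun v => G v i j)) u.
Proof.
by move=> uc; exact: smooth_pderivable (smooth_pd b (metric_smooth g cA i j)) uc.
Qed.

Lemma metricC u i j : cimg c u -> G u i j = G u j i.
Proof. by move=> uc; have /matrixP/(_ j i) := Defs.metric_sym g cA uc; rewrite mxE. Qed.

Lemma inv_metricC u i j : cimg c u -> invmx (G u) i j = invmx (G u) j i.
Proof.
move=> uc; have /matrixP/(_ j i) := trmx_inv (G u).
by rewrite mxE (Defs.metric_sym g cA uc).
Qed.

Lemma mul_inv_metric u i j : cimg c u ->
  \sum_k invmx (G u) i k * G u k j = (i == j)%:R.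
Proof.
move=> uc; have /matrixP/(_ i j) := mulVmx (metric_nondegenerate g cA uc).
by rewrite !mxE.
Qed.

Lemma mul_metric_inv u i j : cimg c u ->
  \sum_k G u i k * invmx (G u) k j = (i == j)%:R.
Proof.
move=> uc; have /matrixP/(_ i j) := mulmxV (metric_nondegenerate g cA uc).
by rewrite !mxE.
Qed.

Lemma pderivable_christoffel u a i j k :
  cimg c u -> pderivable a (fun v => Gam v i j k) u.
Proof.
move=> uc; apply: pderivableZ; apply: pderivable_sum => d; apply: pderivableM.
  apply: pderivable_invmx => [|p q]; last exact: pderivable_metric.
  by apply: filterS (near_cimg uc) => v; exact: metric_nondegenerate.
apply: pderivableB; last exact: pderivable_pd_metric.
by apply: pderivableD; exact: pderivable_pd_metric.
Qed.

Lemma pd_christoffelC u a i j k : cimg c u ->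
  pd a (fun v => Gam v i j k) u = pd a (fun v => Gam v i k j) u.
Proof.
move=> uc; apply: near_eq_pd; apply: filterS (near_cimg uc) => v vc.
exact: christoffelC.
Qed.

Let dg u a i j := pd a (fun v => G v i j) u.
Let ddg u a b i j := pd a (pd b (fun v => G v i j)) u.
Let dGam u a i j k := pd a (fun v => Gam v i j k) u.

Lemma nabla_coordinate_field i :
  nabla_vector G (coordinate_field i) = fun v k j => Gam v j k i.
Proof.
apply/funext => v; apply/funext => k; apply/funext => j.
rewrite /nabla_vector /coordinate_field pd_cst add0r (bigD1 i)//= eqxx mulr1.
by rewrite big1 ?addr0// => m /negbTE->; rewrite mulr0.
Qed.

(** The terms in Gamma^m_lk drop out of the commutator because the connection is torsion free. *)
Lemma curvatureE u j i l k : cimg c u ->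
  curvature G u j i l k = curv (Gam u) (dGam u) j i l k.
Proof.
move=> uc; rewrite /curvature nabla_coordinate_field /nabla_mixed /curv.
have gC : \sum_m Gam u m l k * Gam u j m i = \sum_m Gam u m k l * Gam u j m i.
  by apply: eq_bigr => m _; rewrite (christoffelC g cA uc m l k).
suff regroup (x y s t p q : R) :
  s = t -> x - s + p - (y - t + q) = x - y + (p - q) by exact: regroup gC.
by move=> ->; ring.
Qed.

Lemma curvatureN u j i k l : curvature G u j i k l = - curvature G u j i l k.
Proof. by rewrite /curvature opprB. Qed.

Lemma curvature_bianchi u j i l k : cimg c u ->
  curvature G u j i l k + curvature G u j l k i + curvature G u j k i l = 0.
Proof.
by move=> uc; rewrite !curvatureE//; apply: curv_bianchi => *;
  [exact: (christoffelC g cA uc)|exact: pd_christoffelC].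
Qed.

Lemma pd_metric u a i j : cimg c u ->
  dg u a i j = \sum_d Gam u d a i * G u d j + \sum_d Gam u d a j * G u i d.
Proof.
move=> uc; have := nabla_metric g cA uc a i j; rewrite /nabla2 !mul0r addr0.
by move=> /eqP; rewrite -addrA -opprD subr_eq0 => /eqP.
Qed.

(** The Koszul formula holds on a neighbourhood of u and may be differentiated; this supplies
    [ddgE]. *)
Lemma pd_lower_christoffel u i j a b : cimg c u ->
  \sum_p (G u i p * dGam u a p b j + Gam u p b j * dg u a i p) =
  2^-1 * (ddg u a b j i + ddg u a j b i - ddg u a i b j).
Proof.
move=> uc; transitivity (pd a (fun v => \sum_p G v i p * Gam v p b j) u).
  rewrite pd_sum => [|p]; last first.
    by apply: pderivableM; [exact: pderivable_metric|exact: pderivable_christoffel].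
  by apply: eq_bigr => p _; rewrite pdM//;
    [exact: pderivable_metric|exact: pderivable_christoffel].
transitivity (pd a (fun v => 2^-1 * (dg v b j i + dg v j b i - dg v i b j)) u).
  apply: near_eq_pd; apply: filterS (near_cimg uc) => v vc.
  apply: lower_Gam => *; [exact: metricC|exact: (christoffelC g cA vc)|].
  exact: pd_metric.
have pdd x y z : pderivable a (fun v => dg v x y z) u.
  exact: pderivable_pd_metric.
have dS := pderivableD (pdd b j i) (pdd j b i).
rewrite (pdZ _ (pderivableB dS (pdd i b j))) (pdB dS (pdd i b j)).
by rewrite (pdD (pdd b j i) (pdd j b i)).
Qed.

Lemma lower_curvature_skew u i j l k : cimg c u ->
  \sum_p G u i p * curvature G u p j l k =
  - \sum_p G u j p * curvature G u p i l k.
Proof.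
move=> uc.
under eq_bigr do rewrite curvatureE//.
under [in RHS]eq_bigr do rewrite curvatureE//.
apply: (@lower_curv_skew _ _ (G u) (dg u) (Gam u) (dGam u) _ _ (ddg u)) => *.
- exact: metricC.
- exact: pd_metric.
- exact: smooth_pdC (metric_smooth g cA _ _) uc.
- apply: near_eq_pd; apply: filterS (near_cimg uc) => v vc.
  apply: near_eq_pd; apply: filterS (near_cimg vc) => w wc.
  exact: metricC.
- exact: pd_lower_christoffel.
Qed.

(** * Covariant derivatives of a function *)

Lemma nabla0_function h : nabla0 G 0 h = fun v a => pd a h v.
Proof.
by apply/funext => v; apply/funext => a; rewrite /nabla0 !mul0r addr0.
Qed.

Lemma hessian2_function h :
  hessian2 G 0 h = fun v b d => pd b (pd d h) v - \sum_m Gam v m b d * pd m h v.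
Proof.
apply/funext => v; apply/funext => b; apply/funext => d.
by rewrite /hessian2 nabla0_function /nabla1 !mul0r addr0.
Qed.

Lemma hessian2C h u b d : smooth_on (cimg c) h -> cimg c u ->
  hessian2 G 0 h u b d = hessian2 G 0 h u d b.
Proof.
move=> sh uc; rewrite hessian2_function (smooth_pdC b d sh uc); congr (_ - _).
by apply: eq_bigr => m _; rewrite (christoffelC g cA uc m b d).
Qed.

Lemma pderivable_hessian2 h u a b d : smooth_on (cimg c) h -> cimg c u ->
  pderivable a (fun v => hessian2 G 0 h v b d) u.
Proof.
move=> sh uc; rewrite hessian2_function; apply: pderivableB.
  exact: smooth_pderivable (smooth_pd b (smooth_pd d sh)) uc.
apply: pderivable_sum => m; apply: pderivableM; first exact: pderivable_christoffel.
exact: smooth_pderivable (smooth_pd m sh) uc.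
Qed.

Lemma hessian3E h u a b d : hessian3 G 0 h u a b d =
  pd a (fun v => hessian2 G 0 h v b d) u
  - \sum_m Gam u m a b * hessian2 G 0 h u m d
  - \sum_m Gam u m a d * hessian2 G 0 h u b m.
Proof. by rewrite /hessian3 /nabla2 mul0r mul0r mul0r addr0. Qed.

Lemma hessian3C h u a b d : smooth_on (cimg c) h -> cimg c u ->
  hessian3 G 0 h u a b d = hessian3 G 0 h u a d b.
Proof.
move=> sh uc; have E1 : pd a (fun v => hessian2 G 0 h v b d) u =
    pd a (fun v => hessian2 G 0 h v d b) u.
  by apply: near_eq_pd; apply: filterS (near_cimg uc) => v; exact: hessian2C.
have E2 x y z : \sum_m Gam u m x y * hessian2 G 0 h u m z =
    \sum_m Gam u m x y * hessian2 G 0 h u z m.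
  by apply: eq_bigr => m _; rewrite (hessian2C m z sh uc).
suff regroup (p p' s s' t t' : R) : p = p' -> s = t' -> s' = t ->
    p - s - t = p' - s' - t'.
  by rewrite !hessian3E; exact: (regroup _ _ _ _ _ _ E1 (E2 a b d) (E2 a d b)).
by move=> -> -> ->; ring.
Qed.

Lemma hessian3_commutator h u a b d : smooth_on (cimg c) h -> cimg c u ->
  hessian3 G 0 h u a b d - hessian3 G 0 h u b a d =
  - \sum_m curvature G u m d a b * pd m h u.
Proof.
move=> sh uc; under eq_bigr do rewrite curvatureE//.
have pdh m x : pderivable x (pd m h) u.
  exact: smooth_pderivable (smooth_pd m sh) uc.
have pdhess x y : pd x (fun v => hessian2 G 0 h v y d) u =
    pd x (pd y (pd d h)) u - \sum_m (Gam u m y d * pd x (pd m h) u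
                                      + pd m h u * dGam u x m y d).
  rewrite hessian2_function pdB; last 2 first.
  - exact: smooth_pderivable (smooth_pd y (smooth_pd d sh)) uc.
  - apply: pderivable_sum => m; apply: pderivableM => //.
    exact: pderivable_christoffel.
  congr (_ - _); rewrite pd_sum => [|m]; last first.
    by apply: pderivableM => //; exact: pderivable_christoffel.
  by apply: eq_bigr => m _; rewrite pdM//; exact: pderivable_christoffel.
rewrite !hessian3E !pdhess hessian2_function.
apply: (@hess_commutator _ _ (Gam u) (dGam u) _ (fun m => pd m h u)
  (fun x y => pd x (pd y h) u) (fun x y z => pd x (pd y (pd z h)) u)) => *.
- exact: (christoffelC g cA uc).
- exact: smooth_pdC (smooth_pd _ sh) uc.
Qed.

(** * The parallel density and weighted derivatives *)

Definition volume_power := metric_density_comp g c.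

(** Gamma^d_ad is the logarithmic derivative of |det g|^(1/2). Weight 2 multiplies it by 2/(n+1),
    which cancels the logarithmic derivative of |det g|^(-1/(n+1)). *)
Lemma pd_volume_power u a : cimg c u ->
  pderivable a volume_power u /\
  nabla0 G 2 volume_power u a = 0.
Proof.
move=> uc; have dG i j := pderivable_metric a i j uc.
have [dV VE] := pd_powR_det (- n.+1%:R^-1) (metric_nondegenerate g cA uc) dG.
split; first exact: dV.
rewrite /nabla0 [pd a _ u]VE.
have -> : \sum_d Gam u d a d =
    2^-1 * \sum_i \sum_j invmx (G u) i j * dg u a j i.
  rewrite /christoffel -mulr_sumr; congr (_ * _).
  (* The last two sums agree by symmetry of the inverse metric. *)
  transitivity (\sum_i \sum_j invmx (G u) i j * dg u a j i
      + (\sum_i \sum_j invmx (G u) i j * dg u i a j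
         - \sum_i \sum_j invmx (G u) i j * dg u j a i)).
    rewrite -sumrB -big_split; apply: eq_bigr => i _.
    rewrite -sumrB -big_split; apply: eq_bigr => j _.
    have -> : dg u a j i = pd a (fun v => G v i j) u.
      by apply: near_eq_pd; apply: filterS (near_cimg uc) => v vc; exact: metricC.
    by rewrite /= -mulrBr -mulrDr addrA.
  rewrite [X in _ + (_ - X)]exchange_big/=.
  suff -> : \sum_i \sum_j invmx (G u) i j * dg u i a j =
            \sum_j \sum_i invmx (G u) i j * dg u j a i by rewrite subrr addr0.
  by apply: eq_bigr => i _; apply: eq_bigr => j _; rewrite (inv_metricC i j).
rewrite -/(volume_power u).
suff cancel (V S : R) : - n.+1%:R^-1 * V * S + 2 / n.+1%:R * (2^-1 * S) * V = 0.
  exact: cancel.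
by field; rewrite addrC natr1 pnatr_eq0.
Qed.

Lemma volume_power_neq0 u : cimg c u -> volume_power u != 0.
Proof.
move=> uc; rewrite gt_eqF// powR_gt0// normr_gt0 -unitfE -unitmxE.
exact: metric_nondegenerate.
Qed.

(** The part of the weighted derivative common to all ranks; the Christoffel terms of the tensor
    indices are linear over functions. *)
Lemma nabla_volume_power h u a : cimg c u -> pderivable a h u ->
  pd a (fun v => volume_power v * h v) u
  + 2 / n.+1%:R * (\sum_d Gam u d a d) * (volume_power u * h u)
  = volume_power u * pd a h u.
Proof.
move=> uc dh; have [dV V0] := pd_volume_power a uc.
rewrite (pdM dV dh); move: V0; rewrite /nabla0.
suff aux (V p q x y : R) : q + x * V = 0 -> V * p + y * q + x * (V * y) = V * p.
  exact: aux.
by move=> E; have -> : q = - (x * V) by [apply/eqP; rewrite -addr_eq0 E]; ring.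
Qed.

Lemma nabla0_volume_power h u a : cimg c u -> pderivable a h u ->
  nabla0 G 2 (fun v => volume_power v * h v) u a =
  volume_power u * nabla0 G 0 h u a.
Proof.
by move=> uc dh; rewrite nabla0_function; exact: nabla_volume_power.
Qed.

Lemma nabla1_volume_power (t s : 'rV[R]_n -> 'I_n -> R) u a b : cimg c u ->
  (forall v, cimg c v -> forall j, t v j = volume_power v * s v j) ->
  pderivable a (fun v => s v b) u ->
  nabla1 G 2 t u a b = volume_power u * nabla1 G 0 s u a b.
Proof.
move=> uc ts ds; have E := nabla_volume_power uc ds.
have E1 : pd a (fun v => t v b) u = pd a (fun v => volume_power v * s v b) u.
  by apply: near_eq_pd; apply: filterS (near_cimg uc) => v vc; exact: ts.
have E2 : \sum_d Gam u d a b * t u d = volume_power u * \sum_d Gam u d a b * s u d.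
  by rewrite mulr_sumr; apply: eq_bigr => d _; rewrite ts// mulrCA.
suff aux (V p p' q q' x y y' z : R) : p = p' -> q = V * q' -> y = V * y' ->
    p' + x * (V * y') = V * z ->
    p - q + x * y = V * (z - q' + 0 / n.+1%:R * (\sum_d Gam u d a d) * y').
  exact: (aux _ _ _ _ _ _ _ _ _ E1 E2 (ts u uc b) E).
by move=> -> -> -> {}E; rewrite 2!mul0r mul0r addr0 mulrBr -E; ring.
Qed.

Lemma nabla2_volume_power (t s : 'rV[R]_n -> 'I_n -> 'I_n -> R) u a b d :
  cimg c u ->
  (forall v, cimg c v -> forall i j, t v i j = volume_power v * s v i j) ->
  pderivable a (fun v => s v b d) u ->
  nabla2 G 2 t u a b d = volume_power u * nabla2 G 0 s u a b d.
Proof.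
move=> uc ts ds; have E := nabla_volume_power uc ds.
have E1 : pd a (fun v => t v b d) u = pd a (fun v => volume_power v * s v b d) u.
  by apply: near_eq_pd; apply: filterS (near_cimg uc) => v vc; exact: ts.
have E2 : \sum_m Gam u m a b * t u m d =
    volume_power u * \sum_m Gam u m a b * s u m d.
  by rewrite mulr_sumr; apply: eq_bigr => m _; rewrite ts// mulrCA.
have E3 : \sum_m Gam u m a d * t u b m =
    volume_power u * \sum_m Gam u m a d * s u b m.
  by rewrite mulr_sumr; apply: eq_bigr => m _; rewrite ts// mulrCA.
suff aux (V p p' q q' r r' x y y' z : R) : p = p' -> q = V * q' -> r = V * r' ->
    y = V * y' -> p' + x * (V * y') = V * z ->
    p - q - r + x * y =
    V * (z - q' - r' + 0 / n.+1%:R * (\sum_m Gam u m a m) * y').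
  exact: (aux _ _ _ _ _ _ _ _ _ _ _ E1 E2 E3 (ts u uc b d) E).
by move=> -> -> -> -> {}E; rewrite 2!mul0r mul0r addr0 !mulrBr -E; ring.
Qed.

Lemma hessian3_volume_power h u a b d : smooth_on (cimg c) h -> cimg c u ->
  hessian3 G 2 (fun v => volume_power v * h v) u a b d =
  volume_power u * hessian3 G 0 h u a b d.
Proof.
move=> sh uc; apply: nabla2_volume_power => // [v vc i j|].
  apply: nabla1_volume_power => // [w wc k|].
    by apply: nabla0_volume_power => //; exact: smooth_pderivable sh wc.
  by rewrite nabla0_function; exact: smooth_pderivable (smooth_pd j sh) vc.
exact: pderivable_hessian2.
Qed.

(** The parallel factor passes through every derivative, and the term with nabla B vanishes since B
    is constant. *)
Lemma third_order_volume_power h (B : R) u i j k :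
  smooth_on (cimg c) h -> cimg c u ->
  third_order_operator G (fun=> B) (fun v => h v * volume_power v) u i j k =
  volume_power u * (sym3 (hessian3 G 0 h u) i j k
    + 4 * B * sym3 (fun a b d => G u a b * nabla0 G 0 h u d) i j k).
Proof.
move=> sh uc.
have -> : (fun v => h v * volume_power v) = (fun v => volume_power v * h v).
  by apply/funext => v; rewrite mulrC.
have E0 a : nabla0 G 2 (fun v => volume_power v * h v) u a =
    volume_power u * nabla0 G 0 h u a.
  by apply: nabla0_volume_power => //; exact: smooth_pderivable sh uc.
have E3 a b d := hessian3_volume_power a b d sh uc.
have EB a : nabla0 G 0 (fun=> B) u a = 0 by rewrite nabla0_function pd_cst.
rewrite /third_order_operator /sym3 !E0 !E3 !EB.
move: (hessian3 G 0 h u) (nabla0 G 0 h u) (volume_power u) => T D V.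
by ring.
Qed.

Lemma flat_grad h u a : cimg c u ->
  \sum_j G u a j * grad G h u j = pd a h u.
Proof.
move=> uc; rewrite /grad nabla0_function.
apply: (@lower_ginv _ _ (G u) (invmx (G u)) _ (fun b => pd b h u)) => i j.
exact: mul_metric_inv.
Qed.

Lemma grad_eq0 h u : cimg c u ->
  (forall i, grad G h u i = 0) <-> (forall i, pd i h u = 0).
Proof.
move=> uc; split=> h0 i.
  by rewrite -flat_grad// big1// => j _; rewrite h0 mulr0.
by rewrite /grad nabla0_function big1// => j _; rewrite h0 mulr0.
Qed.

(** * The equivalence at a point of a chart *)

Hypothesis n_ge2 : (2 <= n)%N.

(** [third_order_equiv] for the third covariant derivative of h and v = grad h, whose lowering is
    dh; the density factor cancels because it is nonzero. *)
Lemma GOT_equiv h (B : R) u : smooth_on (cimg c) h -> cimg c u ->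
  (forall i j k, GOT G B h u i j k = 0) <->
  const_curv (G u) (curvature G u) (grad G h u) B /\
  forall i j k, third_order_operator G (fun=> B)
    (fun v => h v * volume_power v) u i j k = 0.
Proof.
move=> sh uc.
have flatE a : nabla0 G 0 h u a = \sum_j G u a j * grad G h u j.
  by rewrite flat_grad// nabla0_function.
have comm a b d : hessian3 G 0 h u a b d - hessian3 G 0 h u b a d =
    - \sum_m curvature G u m d a b * \sum_j G u m j * grad G h u j.
  by rewrite hessian3_commutator//; under [in RHS]eq_bigr do rewrite flat_grad//.
have [||||Tthird thirdT] := @third_order_equiv _ n (G u) (invmx (G u))
  (curvature G u) _ _ _ (hessian3 G 0 h u) (grad G h u) B _ comm.
- by move=> i j; exact: metricC.
- by move=> i j; exact: mul_inv_metric.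
- by move=> i j k l; exact: lower_curvature_skew.
- by move=> i j k; exact: hessian3C.
have symE i j k : sym3 (fun a b d => G u a b * nabla0 G 0 h u d) i j k =
    sym3 (fun a b d => G u a b * \sum_m G u d m * grad G h u m) i j k.
  by rewrite /sym3 !flatE.
split=> [got|[Cv third] i j k].
  have [|Cv S0] := Tthird.
    by move=> i j k; have := got i j k; rewrite /GOT !flatE.
  split=> // i j k; rewrite third_order_volume_power// symE.
  by rewrite [X in _ * X]S0 mulr0.
rewrite /GOT !flatE; apply: thirdT; split=> // a b d; rewrite -/(sym3 _ _ _ _).
apply: (mulfI (volume_power_neq0 uc)); rewrite mulr0.
by have := third a b d; rewrite third_order_volume_power// symE.
Qed.

Lemma is_Bg_const_curv u (v : 'I_n -> R) (B : R) : cimg c u -> (exists i, v i != 0) ->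
  const_curv (G u) (curvature G u) v B -> is_Bg G u B.
Proof.
move=> uc v0 Cv; split.
  exists v => //.
  by apply: (@const_curv_nullity _ n n_ge2 (G u) (curvature G u) v B).
move=> w Ww; apply: (@nullity_eigenvalue _ n n_ge2 (G u) (invmx (G u))
  (curvature G u) _ _ _ _ _ _ _ v B w Cv v0 Ww) => *.
- exact: metricC.
- exact: mul_inv_metric.
- exact: mul_metric_inv.
- exact: inv_metricC.
- exact: curvatureN.
- exact: curvature_bianchi.
- exact: lower_curvature_skew.
Qed.

Lemma is_Bg_nullity_const_curv u (v : 'I_n -> R) (B : R) : cimg c u ->
  in_nullity G u v -> is_Bg G u B -> const_curv (G u) (curvature G u) v B.
Proof.
move=> uc Wv [_ /(_ v Wv) Bv].
apply: (@nullity_const_curv _ n (G u) (invmx (G u))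
  (curvature G u) _ _ _ _ _ _ v B Wv Bv) => *.
- exact: mul_inv_metric.
- exact: mul_metric_inv.
- exact: inv_metricC.
- exact: curvatureN.
- exact: curvature_bianchi.
- exact: lower_curvature_skew.
Qed.

End ChartGeometry.

(** * Change of chart and the theorem *)

Section ChartChange.
Variables (R : realType) (n : nat) (M : manifold R n).
Variables (f : M -> R) (f_smooth : smooth_function f).
Implicit Types (c d : chart R n M) (x y : M).

Lemma coord_param c u : cimg c u -> c (param c u) = u /\ cdom c (param c u).
Proof. by case=> x cx <-; rewrite coordK. Qed.

Lemma near_param c x (P : set M) : cdom c x -> (\forall y \near x, P y) ->
  \forall u \near c x, P (param c u).
Proof.
move=> cx Px; have ux : cimg c (c x) by exists x.
have := param_continuous (c := c); rewrite continuous_open_subspace.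
  by move=> /(_ (c x)); rewrite inE => /(_ ux); apply; rewrite coordK.
exact: cimg_open.
Qed.

Lemma near_coord c x (P : set 'rV[R]_n) : cdom c x ->
  (\forall u \near c x, P u) -> \forall y \near x, P (c y).
Proof.
move=> cx; have := @Defs.coord_continuous _ _ _ c; rewrite continuous_open_subspace.
  by move=> /(_ x); rewrite inE => /(_ cx); apply.
exact: cdom_open.
Qed.

(** Makes being a critical point of f independent of the chart. Near the point the two local
    expressions differ by the transition map, so the chain rule at critical points suffices. *)
Lemma critical_chart c d x : atlas c -> atlas d -> cdom c x -> cdom d x ->
  (forall b, pd b (f \o param d) (d x) = 0) ->
  forall a, pd a (f \o param c) (c x) = 0.
Proof.
move=> cA dA cx dx f0 a; have ux : cimg c (c x) by exists x.
have phix : transition c d (c x) = d x by rewrite /transition coordK.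
have overlap : (c @` (cdom c `&` cdom d)) (c x) by exists x.
have smooth_phi b := atlas_compatible cA dA b.
transitivity (pd a ((f \o param d) \o transition c d) (c x)).
  apply: near_eq_pd; have nd : \forall y \near x, cdom d y.
    by apply: open_nbhs_nbhs; split=> //; exact: cdom_open.
  apply: filterS (near_param cx nd) => u du.
  by rewrite /= /transition coordK.
apply: (@pd_comp_critical _ _ _ (cimg d)); rewrite ?phix.
- exact: cimg_open.
- exact: f_smooth.
- by exists x.
- exact: f0.
- by move=> b; have [cont _] := smooth_phi b 1%N; exact: cont.
- move=> b; have [_ /(_ a)[dphi _]] := smooth_phi b 1%N.
  by split; exact: dphi.
Qed.

End ChartChange.

Theorem theorem3p13 (R : realType) (n : nat) (n_ge2 : (2 <= n)%N)
    (M : manifold R n) (g : metric M) (B0 : R)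
    (f : M -> R) (f_smooth : smooth_function f) :
  (forall c : chart R n M, atlas c -> forall u, cimg c u ->
     forall i j k : 'I_n, GOT (g c) B0 (f \o param c) u i j k = 0)
  <->
  [/\ forall c : chart R n M, atlas c -> forall u, cimg c u ->
        in_nullity (g c) u (grad (g c) (f \o param c) u),
      forall U : set M, open U ->
        (forall x, U x -> forall c : chart R n M, atlas c -> cdom c x ->
           exists i, grad (g c) (f \o param c) (c x) i != 0) ->
        forall x, U x -> forall c : chart R n M, atlas c -> cdom c x ->
          is_Bg (g c) (c x) B0
    & forall c : chart R n M, atlas c -> forall u, cimg c u ->
        forall i j k : 'I_n,
          third_order_operator (g c) (fun=> B0)
            (mul_density f (metric_density g) c) u i j k = 0].
Proof.
have sf c : atlas c -> smooth_on (cimg c) (f \o param c) by exact: f_smooth.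
have equiv (c : chart R n M) (cA : atlas c) u (uc : cimg c u) :=
  GOT_equiv g cA B0 (sf c cA) uc.
split=> [got|[Wf Bf third] c cA u uc].
  have Cf (c : chart R n M) (cA : atlas c) u (uc : cimg c u) :=
    ((equiv c cA u uc).1 (got c cA u uc)).1.
  split=> [c cA u uc|U oU U0 x Ux c cA cx|c cA u uc].
  - by have /(const_curv_nullity n_ge2) := Cf c cA u uc.
  - have uc : cimg c (c x) by exists x.
    have u0 := U0 x Ux c cA cx; have cf := Cf c cA _ uc.
    exact: (is_Bg_const_curv cA n_ge2 uc u0 cf).
  - exact: ((equiv c cA u uc).1 (got c cA u uc)).2.
apply/(equiv c cA u uc); split; last exact: third.
(* At a critical point both sides of [const_curv] are zero. *)
have [[i fi]|f0] := pselect (exists i, grad (g c) (f \o param c) u i != 0); last first.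
  have f00 i : grad (g c) (f \o param c) u i = 0.
    by apply/eqP/negP => /negP fi; apply: f0; exists i.
  move=> i k l; rewrite big1 => [|j _]; last by rewrite f00 mulr0.
  by rewrite !big1 ?mulr0 ?subr0 ?mulr0// => j _; rewrite f00 mulr0.
(* Away from the critical points of [f], (ii) applies to the open set of all
   noncritical points. *)
have [cu dom_u] := coord_param uc.
pose U := [set x | forall d, atlas d -> cdom d x ->
  exists i, grad (g d) (f \o param d) (d x) i != 0].
(* A gradient vanishing in some chart e would vanish in d as well, by [critical_chart]. *)
have noncritical d x : atlas d -> cdom d x ->
    (exists i, grad (g d) (f \o param d) (d x) i != 0) -> U x.
  move=> dA dx [j fj] e eA ex; apply: contrapT => f0.
  have xe : cimg e (e x) by exists x.
  have xd : cimg d (d x) by exists x.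
  have e0 : forall k, grad (g e) (f \o param e) (e x) k = 0.
    by move=> k; apply/eqP/negP => /negP fk; apply: f0; exists k.
  have d0 := critical_chart f_smooth dA eA dx ex ((grad_eq0 g eA _ xe).1 e0).
  by move: fj; rewrite ((grad_eq0 g dA _ xd).2 d0) eqxx.
(* Some partial derivative of f is nonzero at x and, being continuous, nonzero nearby. *)
have oU : open U.
  rewrite openE => x Ux; have [d dA dx] := atlas_cover x.
  have xd : cimg d (d x) by exists x.
  have [k fk] : exists k, pd k (f \o param d) (d x) != 0.
    apply: contrapT => f0; have [j] := Ux d dA dx.
    rewrite ((grad_eq0 g dA _ xd).2 _) ?eqxx// => k.
    by apply/eqP/negP => /negP fk; apply: f0; exists k.
  have [_ /(_ k)[_ [cont _]]] := sf d dA 1%N.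
  have near_fk : \forall v \near d x, cimg d v /\ pd k (f \o param d) v != 0.
    apply: filterI; first exact: near_cimg.
    by have /cvgr_neq0 := cont _ xd; apply.
  have near_d : \forall y \near x, cdom d y.
    by apply: open_nbhs_nbhs; split=> //; exact: cdom_open.
  have := near_coord dx near_fk; apply: filterS2 near_d => y dy [yd fy].
  apply: (noncritical d y dA dy); apply: contrapT => f0.
  case/negP: fy; apply/eqP; apply: (grad_eq0 g dA _ yd).1 => j.
  by apply/eqP/negP => /negP fj; apply: f0; exists j.
have Uu : U (param c u).
  by apply: (noncritical c) => //; rewrite cu; exists i.
have Bu := Bf U oU (fun x Ux d dA dx => Ux d dA dx) _ Uu c cA dom_u.
by apply: (is_Bg_nullity_const_curv cA uc (Wf c cA u uc)); rewrite cu in Bu.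
Qed.
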